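(* Let $M\to N$ be an oriented matroid perspective on a linearly ordered set $E$. Denote by $t_{i,j}$ the coefficient of $x^iy^j$ in $t(M,N;x,y,1)$. (1) $t_{i,j}$ equals the number of activity classes of reorientations of $M\to N$ with $i$ dual-active elements and $j$ active elements. Equally, $t_{i,j}$ equals the number of reorientations of $M\to N$ with $i$ dual-active elements and $j$ active elements which are active-fixed (w.r.t. $M$) and dual-active-fixed (w.r.t. $N$). (2) Furthermore, the following enumerations hold: - the number of all reorientations $-_AM\to -_AN$ of $M\to N$ is $t(M,N;2,2,1)$; - the number of reorientations with $-_AM$ acyclic is $t(M,N;2,0,1)$; - the number of reorientations with $-_AN$ totally cyclic is $t(M,N;0,2,1)$; - the number of reorientations with $-_AM$ acyclic and $-_AN$ dual-active-fixed, and also the number of activity classes with $-_AM$ acyclic, is $t(M,N;1,0,1)$; - the number of reorientations with $-_AM$ active-fixed and $-_AN$ totally cyclic, and also the number of activity classes with $-_AN$ totally cyclic, is $t(M,N;0,1,1)$; - the number of reorientations with $-_AM$ active-fixed is $t(M,N;2,1,1)$; - the number of reorientations with $-_AN$ dual-active-fixed is $t(M,N;1,2,1)$; - the number of reorientations with $-_AM$ active-fixed and $-_AN$ dual-active-fixed, and also the total number of activity classes, is $t(M,N;1,1,1)$; - the number of reorientations with $-_AM$ acyclic and $-_AN$ totally cyclic, and also the number of activity classes with $-_AM$ acyclic and $-_AN$ totally cyclic, is $t(M,N;0,0,1)$. In particular, $t(M,N;1,1,1)$ counts the total number of activity classes of reorientations.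
   Context: All ground sets are finite. Two signed sets are conformal if they have the same signs on the intersection of their supports. A vector (resp. covector) of an oriented matroid is a conformal union (composition) of circuits (resp. cocircuits). A signed set is positive if all its signs are positive; a positive signed set is identified with its support. An oriented matroid is acyclic if it has no positive circuit, and totally cyclic if it has no positive cocircuit. An ordered pair $(M,N)$ of oriented matroids on the same ground set $E$ is an oriented matroid perspective, denoted $M\to N$, if every circuit of $M$ is a vector of $N$ (equivalently, every cocircuit of $N$ is a covector of $M$). For $A\subseteq E$, $-_AM$ denotes the oriented matroid obtained from $M$ by reorienting $A$, i.e. by reversing the signs of the elements of $A$ in all signed circuits and cocircuits; $-_AM\to -_AN$ is again an oriented matroid perspective. The set of reorientations of $M\to N$ is the set of all $-_AM\to -_AN$ for $A\subseteq E$, regarded as indexed by $2^E$: distinct subsets $A$ count as distinct reorientations, even if the resulting perspectives are equal. The Tutte polynomial of $M\to N$ is $$t(M,N;x,y,z)=\sum_{A\subseteq E}(x-1)^{r(N)-r_N(A)}(y-1)^{|A|-r_M(A)}z^{r(M)-r(N)-(r_M(A)-r_N(A))},$$ where $r_M,r_N$ are the rank functions of the underlying matroids and $r(M)=r_M(E)$, $r(N)=r_N(E)$. For an oriented matroid $M$ on a linearly ordered set $E$, let $$O(M)=\{\min(C)\mid C \text{ positive circuit of } M\},\qquad O^*(M)=\{\min(C)\mid C \text{ positive cocircuit of } M\}.$$ The active elements of a perspective $M\to N$ are the elements of $O(M)$, and its dual-active elements are the elements of $O^*(N)$ (so for the reorientation $-_AM\to -_AN$ they are the elements of $O(-_AM)$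 and of $O^*(-_AN)$, respectively). Active partition. Let $M\to N$ be an oriented matroid perspective on a linearly ordered set $E$, with $O(M)=\{g_1<\dots<g_\varepsilon\}$ and $O^*(N)=\{h_1<\dots<h_\iota\}$. Define $G_\varepsilon=\emptyset$ and, for $0\le k\le \varepsilon-1$, let $G_k$ be the union of all positive circuits $C$ of $M$ with $\min(C)\ge g_{k+1}$. Define $H_\iota=E$ and, for $0\le k\le\iota-1$, let $H_k$ be $E$ minus the union of all positive cocircuits $C$ of $N$ with $\min(C)\ge h_{k+1}$. One has $\emptyset=G_\varepsilon\subset\dots\subset G_0\subseteq H_0\subset\dots\subset H_\iota=E$. The active partition of $M\to N$ is the partition of $E$ into the cyclic parts $G_{k-1}\setminus G_k$ ($1\le k\le\varepsilon$), the acyclic parts $H_k\setminus H_{k-1}$ ($1\le k\le\iota$), and the hybrid part $H_0\setminus G_0$ (possibly empty). Activity classes. The activity class of a reorientation $-_AM\to -_AN$ is the set of all reorientations $-_{A\triangle B}M\to -_{A\triangle B}N$, where $B$ is any union of cyclic or acyclic parts (the hybrid part being excluded) of the active partition of $-_AM\to -_AN$. Reorienting such parts preserves the active partition, with its cyclic, acyclic and hybrid parts, so the activity classes partition the set of reorientations of $M\to N$, and the sets of active and dual-active elements, as well as the properties ''$-_AM$ is acyclic'' and ''$-_AN$ is totally cyclic'', are constant on each activity class. An activity class is said to have $i$ dual-active elements and $j$ active elements, or to have $-_AM$ acyclic, or $-_AN$ totally cyclic, if this holds for its members $-_AM\to -_AN$. The reorientation $-_AM\to -_AN$ is active-fixed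 if $-_AM$ is active-fixed w.r.t. $M$, meaning $O(-_AM)\cap A=\emptyset$; it is dual-active-fixed if $-_AN$ is dual-active-fixed w.r.t. $N$, meaning $O^*(-_AN)\cap A=\emptyset$. *)

(* Defs.v *)
(* MathComp and multinomials. *)
From HB Require Import structures.
From mathcomp Require Import all_boot all_order all_algebra.
From mathcomp Require Import mpoly.

Set Implicit Arguments.
Unset Strict Implicit.
Unset Printing Implicit Defensive.

Import Order.TTheory GRing.Theory.

Section SignedSets.
Variable E : finType.

(* [Some true] is the sign +, [Some false] the sign -, and [None] means that
   the element lies outside the support. *)
Definition signed := {ffun E -> option bool}.

Implicit Types (X Y : signed) (A : {set E}).

Definition pos X : {set E} := [set e | X e == Some true].
Definition neg X : {set E} := [set e | X e == Some false].
Definition supp X : {set E} := [set e | X e != None].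
Definition positive X : bool := neg X == set0.

Definition flip A X : signed :=
  [ffun e => if e \in A then omap negb (X e) else X e].
Definition opp X : signed := flip [set: E] X.

Definition conformal X Y : bool :=
  [forall e in supp X :&: supp Y, X e == Y e].

(* Orthogonality: the supports are disjoint, or X and Y agree somewhere and
   disagree somewhere on the intersection of their supports. *)
Definition orthogonal X Y : bool :=
  (supp X :&: supp Y == set0) ||
  ([exists e in supp X :&: supp Y, X e == Y e] &&
   [exists f in supp X :&: supp Y, X f != Y f]).

Lemma flipE A X e :
  flip A X e = if e \in A then omap negb (X e) else X e.
Proof. by rewrite ffunE. Qed.

Lemma flipK A : involutive (flip A).
Proof.
move=> X; apply/ffunP=> e; rewrite !flipE; case: (e \in A) => //.
by case: (X e) => // b /=; rewrite negbK.
Qed.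

Lemma flipC A B X : flip A (flip B X) = flip B (flip A X).
Proof. by apply/ffunP=> e; rewrite !flipE; case: ifP; case: ifP. Qed.

Lemma supp_flip A X : supp (flip A X) = supp X.
Proof.
by apply/setP=> e; rewrite !inE flipE; case: ifP => // _; case: (X e).
Qed.

Lemma in_pos_flip A X e :
  (e \in pos (flip A X)) = if e \in A then e \in neg X else e \in pos X.
Proof. by rewrite !inE flipE; case: ifP => // _; case: (X e) => [[]|]. Qed.

Lemma in_neg_flip A X e :
  (e \in neg (flip A X)) = if e \in A then e \in pos X else e \in neg X.
Proof. by rewrite !inE flipE; case: ifP => // _; case: (X e) => [[]|]. Qed.

(* The signed circuit axioms, with weak elimination. *)
Record oriented_matroid := OrientedMatroid {
  circuits : {set signed};
  circuit_neq0 : forall X, X \in circuits -> supp X != set0;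
  circuit_opp : forall X, X \in circuits -> opp X \in circuits;
  circuit_incomp : forall X Y, X \in circuits -> Y \in circuits ->
    supp X \subset supp Y -> X = Y \/ X = opp Y;
  circuit_elim : forall X Y e, X \in circuits -> Y \in circuits ->
    X <> opp Y -> e \in pos X :&: neg Y ->
    exists Z, [/\ Z \in circuits,
                  pos Z \subset (pos X :|: pos Y) :\ e
                & neg Z \subset (neg X :|: neg Y) :\ e]
}.

Implicit Types M N : oriented_matroid.

Definition indep M A : bool := [forall C in circuits M, ~~ (supp C \subset A)].

Definition rank M A : nat :=
  \max_(I : {set E} | (I \subset A) && indep M I) #|I|.

(* D is dependent in the dual of the underlying matroid iff
   |D| - r(E) + r(E \ D) < |D|, i.e. iff r(E \ D) < r(E). *)
Definition cocircuit_supp M (D : {set E}) : bool :=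
  minset (fun D' : {set E} => rank M (~: D') < rank M [set: E]) D.

(* The circuits of the dual oriented matroid: the signatures of the cocircuits
   of the underlying matroid that are orthogonal to all signed circuits. *)
Definition cocircuits M : {set signed} :=
  [set X | cocircuit_supp M (supp X) &
           [forall C in circuits M, orthogonal X C]].

(* X is the conformal union of the set S of circuits; S = set0 yields the
   zero vector. *)
Definition vectors M : {set signed} :=
  [set X | [exists S : {set signed},
    [&& S \subset circuits M,
        [forall C in S, forall D in S, conformal C D],
        pos X == \bigcup_(C in S) pos C
      & neg X == \bigcup_(C in S) neg C]]].

Definition perspective M N : bool := circuits M \subset vectors N.

(* Positive (co)circuits, identified with their supports. *)
Definition poscircuits M : {set {set E}} :=
  [set supp X | X in circuits M & positive X].
Definition poscocircuits M : {set {set E}} :=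
  [set supp X | X in cocircuits M & positive X].

Definition acyclic M : bool := poscircuits M == set0.
Definition totally_cyclic M : bool := poscocircuits M == set0.

Section Reorient.
Variables (A : {set E}) (M : oriented_matroid).

Definition reorient_circuits : {set signed} := [set flip A X | X in circuits M].

Lemma in_reorient X : (X \in reorient_circuits) = (flip A X \in circuits M).
Proof.
apply/imsetP/idP => [[Y YM ->]|XM]; first by rewrite flipK.
by exists (flip A X); rewrite ?flipK.
Qed.

Lemma reorient_neq0 X : X \in reorient_circuits -> supp X != set0.
Proof. by rewrite in_reorient => /circuit_neq0; rewrite supp_flip. Qed.

Lemma reorient_opp X : X \in reorient_circuits -> opp X \in reorient_circuits.
Proof. by rewrite !in_reorient /opp flipC => /circuit_opp. Qed.

Lemma reorient_incomp X Y : X \in reorient_circuits ->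
  Y \in reorient_circuits -> supp X \subset supp Y -> X = Y \/ X = opp Y.
Proof.
rewrite !in_reorient => XM YM; rewrite -(supp_flip A X) -(supp_flip A Y) => sXY.
have [/(can_inj (flipK A))|eXY] := circuit_incomp XM YM sXY; first by left.
by right; apply: (can_inj (flipK A)); rewrite eXY /opp flipC.
Qed.

Lemma reorient_elim X Y e : X \in reorient_circuits ->
  Y \in reorient_circuits -> X <> opp Y -> e \in pos X :&: neg Y ->
  exists Z, [/\ Z \in reorient_circuits,
                pos Z \subset (pos X :|: pos Y) :\ e
              & neg Z \subset (neg X :|: neg Y) :\ e].
Proof.
rewrite !in_reorient => XM YM nXY; rewrite in_setI => /andP[eX eY].
suff [Z [ZM Zp Zn]] : exists Z, [/\ Z \in circuits M,
    pos Z \subset (pos (flip A X) :|: pos (flip A Y)) :\ e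
  & neg Z \subset (neg (flip A X) :|: neg (flip A Y)) :\ e].
  exists (flip A Z); split; first by rewrite in_reorient flipK.
    apply/subsetP=> f; rewrite in_pos_flip.
    by case: ifP => fA; [move/(subsetP Zn)|move/(subsetP Zp)];
       rewrite !in_setD1 !in_setU ?in_pos_flip ?in_neg_flip fA.
  apply/subsetP=> f; rewrite in_neg_flip.
  by case: ifP => fA; [move/(subsetP Zp)|move/(subsetP Zn)];
     rewrite !in_setD1 !in_setU ?in_pos_flip ?in_neg_flip fA.
have [eA|eA] := boolP (e \in A).
  have nYX : flip A Y <> opp (flip A X).
    move=> eYX; apply: nXY; apply: (can_inj (flipK A)).
    by rewrite /opp flipC eYX /opp flipK.
  have eYX : e \in pos (flip A Y) :&: neg (flip A X).
    by rewrite in_setI in_pos_flip in_neg_flip eA eX eY.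
  have [Z [ZM Zp Zn]] := circuit_elim YM XM nYX eYX.
  by exists Z; split; rewrite // setUC.
apply: circuit_elim => //.
  by rewrite /opp flipC => /(can_inj (flipK A)).
by rewrite in_setI in_pos_flip in_neg_flip (negPf eA) eX eY.
Qed.

Definition reorient : oriented_matroid :=
  OrientedMatroid reorient_neq0 reorient_opp reorient_incomp reorient_elim.

End Reorient.

(* For a perspective M -> N all truncated subtractions below are exact. *)
Definition tutte M N : {mpoly int[3]} :=
  (\sum_(A : {set E})
     ('X_(0 : 'I_3) - 1) ^+ (rank N [set: E] - rank N A) *
     ('X_(1 : 'I_3) - 1) ^+ (#|A| - rank M A) *
     'X_(2 : 'I_3) ^+ ((rank M [set: E] - rank N [set: E]) -
                       (rank M A - rank N A)))%R.

(* The coefficient of x^i y^j in t(M,N;x,y,1). *)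
Definition tutte_coef M N (i j : nat) : int :=
  ((tutte M N \mPo [tuple 'X_(0 : 'I_2); 'X_(1 : 'I_2); 1])
     @_[multinom [tuple i; j]])%R.

Definition tutte_eval M N (x y z : int) : int :=
  ((tutte M N).@[tnth [tuple x; y; z]])%R.

End SignedSets.

Section Activities.
Variables (disp : Order.disp_t) (E : finOrderType disp).
Implicit Types (M N : oriented_matroid E) (A : {set E}).

Definition is_min (e : E) (C : {set E}) : bool :=
  (e \in C) && [forall f in C, (e <= f)%O].

(* O(M) *)
Definition active M : {set E} :=
  [set e | [exists C in poscircuits M, is_min e C]].

(* O^*(M) *)
Definition dual_active M : {set E} :=
  [set e | [exists C in poscocircuits M, is_min e C]].

Definition sorted_enum A : seq E := sort <=%O (enum A).

Definition min_ge (g : E) (C : {set E}) : bool :=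
  [exists e, is_min e C && (g <= e)%O].

(* G_k and H_k: as sequences are indexed from 0, [onth _ k] is g_(k+1), resp.
   h_(k+1), and it is [None] for k = epsilon, resp. k = iota. *)
Definition cyclic_flat M (k : nat) : {set E} :=
  if onth (sorted_enum (active M)) k is Some g
  then \bigcup_(C in poscircuits M | min_ge g C) C else set0.

Definition acyclic_flat N (k : nat) : {set E} :=
  if onth (sorted_enum (dual_active N)) k is Some h
  then ~: \bigcup_(C in poscocircuits N | min_ge h C) C else [set: E].

(* The cyclic parts of M -> N depend on M only, the acyclic ones on N only. *)
Definition cyclic_parts M : {set {set E}} :=
  [set cyclic_flat M k :\: cyclic_flat M k.+1 | k : 'I_#|active M|].

Definition acyclic_parts N : {set {set E}} :=
  [set acyclic_flat N k.+1 :\: acyclic_flat N k | k : 'I_#|dual_active N|].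

Definition symdiff A B : {set E} := (A :\: B) :|: (B :\: A).

(* The reorientation -_A M -> -_A N is represented by its index A. *)
Definition activity_class M N A : {set {set E}} :=
  [set symdiff A (cover P) |
     P in powerset (cyclic_parts (reorient A M) :|:
                    acyclic_parts (reorient A N))].

Definition activity_classes M N : {set {set {set E}}} :=
  [set activity_class M N A | A : {set E}].

Definition active_fixed M A : bool := active (reorient A M) :&: A == set0.

Definition dual_active_fixed N A : bool :=
  dual_active (reorient A N) :&: A == set0.

End Activities.

(* Main.v *)
From mathcomp Require Import all_boot all_order all_algebra.
From mathcomp Require Import mpoly.
Require Import Defs.

Set Implicit Arguments.
Unset Strict Implicit.
Unset Printing Implicit Defensive.

Import Order.TTheory GRing.Theory.

(** The proof reads off everything from circuits.

    By Farkas' lemma ([farkasP]), there is a positive cocircuit through [e]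
    that avoids a set [L] not containing [e] exactly when no circuit contains
    [e] and is positive outside [L].  So an element [e] is active for the
    reorientation by [A] when some circuit of [reorient A M] through [e] is
    positive and has no element below [e], and it is dual-active when no
    circuit of [reorient A N] through [e] is positive from [e] on.
    Farkas' lemma needs strong circuit elimination, which is first deduced from
    weak elimination.

    Enumeration.  The sum over all reorientations is transformed into the sum
    over all subsets that defines the Tutte polynomial, one element at a time,
    from the greatest to the smallest.  In an intermediate state the elements
    of an upper set [U] are contracted or deleted, while the others still carry
    a sign; whether an element is active only depends on the states from that
    element on.  When the sign of [w] gives way to the alternative between
    contraction and deletion, the activity of [w] itself does not depend on its
    state, and either the state of [w] is irrelevant for all smaller elements,
    or one of the two signs acts on all of them like the contraction of [w] and
    the other sign like its deletion ([step_dichotomy]).  Elements are weighted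
    according to their activity and to their membership in [A]; only the sums
    of the two weights for membership and non-membership matter, and they may
    change along the way.  The last state sum is the defining expansion of the
    Tutte polynomial, so that [tutte_expansion] expresses t(M,N;a+b,c+d,1) as
    the sum over [A] of a product where a and b weigh the dual-active elements
    outside and inside [A], and c and d the active ones.  All counts of
    reorientations follow by letting a, b, c, d be 0, 1 or a variable.

    Classes.  An active element is recovered from the sets [above F t], the
    union of the positive circuits (or cocircuits) without element below [t].
    Reorienting such a union changes none of these sets ([families_flip]); as
    every union of parts of the active partition is a symmetric difference of
    such unions, activity classes are well behaved ([families_saturated]).
    Each part contains exactly one active or dual-active element, hence each
    class contains exactly one reorientation that is both active-fixed and
    dual-active-fixed ([card_classes]), and counting classes amounts to
    counting such reorientations. *)

(** * Strong circuit elimination *)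

Section Elimination.
Variables (E : finType) (M : oriented_matroid E).
Implicit Types (X Y Z W : signed E) (e f g h : E) (b : bool).

Definition between X Y Z :=
  forall h, [\/ Z h = None, Z h = X h | Z h = Y h].

Lemma in_supp X e : (e \in supp X) = (X e != None).
Proof. by rewrite inE. Qed.

Lemma oppE X e : opp X e = omap negb (X e).
Proof. by rewrite flipE inE. Qed.

Lemma oppK X : opp (opp X) = X.
Proof. exact: flipK. Qed.

Lemma in_pos X e : (e \in pos X) = (X e == Some true).
Proof. by rewrite inE. Qed.

Lemma in_neg X e : (e \in neg X) = (X e == Some false).
Proof. by rewrite inE. Qed.

Lemma circuit_opp_iff X : (opp X \in circuits M) = (X \in circuits M).
Proof.
by apply/idP/idP=> [/circuit_opp|/circuit_opp //]; rewrite oppK.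
Qed.

(** The axiom eliminates an element positive in [X]; as [X] and [Y] may be
    exchanged, its sign does not matter. *)
Lemma weak_elim X Y e b :
  X \in circuits M -> Y \in circuits M -> X <> opp Y ->
  X e = Some b -> Y e = Some (~~ b) ->
  exists Z, [/\ Z \in circuits M, Z e = None & between X Y Z].
Proof.
suff elim1 X' Y' : X' \in circuits M -> Y' \in circuits M -> X' <> opp Y' ->
    X' e = Some true -> Y' e = Some false ->
    exists Z, [/\ Z \in circuits M, Z e = None & between X' Y' Z].
  case: b => XM YM nXY Xe Ye; first exact: elim1 Xe Ye.
  have nYX : Y <> opp X by move=> eY; apply: nXY; rewrite eY oppK.
  have [Z [ZM Ze bZ]] := elim1 _ _ YM XM nYX Ye Xe.
  by exists Z; split=> // h; case: (bZ h) => ->; auto using or3.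
move=> XM YM nXY Xe Ye.
have eXY : e \in pos X' :&: neg Y' by rewrite !inE Xe Ye.
have [Z [ZM /subsetP Zp /subsetP Zn]] := circuit_elim XM YM nXY eXY.
exists Z; split=> //.
  case Ze: (Z e) => [[]|] //.
    by have := Zp e; rewrite !inE Ze eqxx /= => /(_ isT).
  by have := Zn e; rewrite !inE Ze eqxx /= => /(_ isT).
move=> h; case Zh: (Z h) => [[]|]; last by constructor 1.
  have := Zp h; rewrite !inE Zh eqxx => /(_ isT)/andP[_ /orP[]/eqP->].
    by constructor 2.
  by constructor 3.
have := Zn h; rewrite !inE Zh eqxx => /(_ isT)/andP[_ /orP[]/eqP->].
  by constructor 2.
by constructor 3.
Qed.

(** Strong elimination when the element to be kept lies outside [Y].  It is a
    property of the pair because the proof by induction on the union of the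
    supports uses it for several other pairs. *)
Definition keeps_outside X Y := forall e f b,
  X e = Some b -> Y e = Some (~~ b) -> X f <> None -> Y f = None ->
  exists Z, [/\ Z \in circuits M, Z e = None, Z f = X f & between X Y Z].

Lemma between_supp X Y Z : between X Y Z -> supp Z \subset supp X :|: supp Y.
Proof.
move=> bZ; apply/subsetP=> h; rewrite !inE.
by case: (bZ h) => ->; rewrite ?eqxx // => ->; rewrite ?orbT.
Qed.

(** A circuit whose wrong signs are all opposite to those of a circuit [W]
    lying between [X] and [Y] is corrected by eliminating them against [W]
    one after the other: no step creates a new wrong sign. *)
Lemma repair X Y W Z e f :
  W \in circuits M -> between X Y W -> W e = None -> W f = None ->
  (forall Z', Z' \in circuits M -> Z' e = None ->
     supp Z' \subset supp X :|: supp Y -> keeps_outside Z' W) ->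
  Z \in circuits M -> Z e = None -> X f <> None -> Z f = X f ->
  (forall h, [\/ Z h = None, Z h = X h, Z h = Y h | Z h = opp W h]) ->
  exists Z', [/\ Z' \in circuits M, Z' e = None, Z' f = X f & between X Y Z'].
Proof.
move=> WM bW We Wf elimW ZM Ze Xf Zf bZ.
pose bad Z' := [set h | [&& Z' h != None, Z' h != X h & Z' h != Y h]].
have [n le_bad] := ubnP #|bad Z|.
elim: n Z le_bad ZM Ze Zf bZ => // n IHn Z le_bad ZM Ze Zf bZ.
have [bad0|[h]] := set_0Vmem (bad Z).
  exists Z; split=> // h; move/setP/(_ h): bad0; rewrite !inE.
  case: eqP => [->|_]; first by constructor 1.
  case: eqP => [->|_]; first by constructor 2.
  by case: eqP => // -> _; constructor 3.
move=> hbad; move: (hbad); rewrite inE => /and3P[Zh0 ZhX ZhY].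
have ZhW : Z h = opp W h.
  by case: (bZ h) => // eZ; rewrite eZ eqxx in Zh0 ZhX ZhY.
have sZ : supp Z \subset supp X :|: supp Y.
  apply/subsetP=> k; rewrite !inE.
  case: (bZ k) => ->; rewrite ?oppE //; try by move=> ->; rewrite ?orbT.
  by case: (bW k) => -> //; case: (_ k) => //= ? _; rewrite ?orbT.
move: (ZhW); rewrite oppE; case eWh: (W h) => [c|]; last first.
  by move=> eZ; rewrite eZ eqxx in Zh0.
move=> /= Zh; have Wh : W h = Some (~~ ~~ c) by rewrite negbK.
have Zf0 : Z f <> None by rewrite Zf.
have [Z1 [Z1M Z1h Z1f bZ1]] := elimW Z ZM Ze sZ _ _ _ Zh Wh Zf0 Wf.
apply: (IHn Z1) => //; last 2 first.
- by rewrite Z1f.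
- move=> k; case: (bZ1 k) => ->; first by constructor 1.
    exact: bZ.
  case: (bW k) => ->; [constructor 1|constructor 2|constructor 3] => //.
- move: le_bad; rewrite ltnS; apply: leq_trans.
  apply/proper_card/properP; split; last first.
    by exists h => //; rewrite inE Z1h.
  apply/subsetP=> k; rewrite !inE => /and3P[k0 kX kY].
  case: (bZ1 k) => eZ; rewrite -?eZ ?k0 ?kX //; first by rewrite eZ in k0.
  by case: (bW k) => eW; move: k0 kX kY; rewrite eZ eW eqxx.
by case: (bZ1 e) => ->.
Qed.

(** As circuits are incomparable, [W] has an element outside [X]. *)
Lemma elim_not_sub X Y W e b : X \in circuits M -> W \in circuits M ->
  X e = Some b -> W e = None -> between X Y W ->
  exists g c, [/\ X g = None, Y g = Some c & W g = Some c].
Proof.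
move=> XM WM Xe We bW.
have nWX : ~~ (supp W \subset supp X).
  apply/negP=> /(circuit_incomp WM XM)[] eW; move: We; rewrite eW ?oppE Xe //.
have /subsetPn[g] := nWX; rewrite !inE negbK => Wg /eqP Xg.
exists g; case: (bW g) => eW; move: Wg; rewrite eW ?Xg //.
by case: (Y g) eW => // c eW _; exists c.
Qed.

(** If weak elimination of [e] gives a circuit [W] that misses [f], some [g] of
    [Y] in [W] lies outside [X].  Eliminating [g] from [Y] with the help of
    [opp W] gives a circuit [Y1] which still contains [e], and [f] can be kept
    by induction when [e] is eliminated between [X] and [Y1], since [g] has
    gone.  The signs that [opp W] has introduced are then repaired. *)
Lemma strong_elim_outside X Y :
  X \in circuits M -> Y \in circuits M -> keeps_outside X Y.
Proof.
have [n] := ubnP #|supp X :|: supp Y|.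
elim: n X Y => // n IHn X Y ltn XM YM e f b Xe Ye Xf Yf.
have nXY : X <> opp Y by move=> eX; apply: Xf; rewrite eX oppE Yf.
have [W [WM We bW]] := weak_elim XM YM nXY Xe Ye.
have [Wf|Wf] := eqVneq (W f) None; last first.
  exists W; split=> //.
  by case: (bW f) => // eW; rewrite eW ?Yf in Wf *.
have IH X' Y' k : X' \in circuits M -> Y' \in circuits M ->
    supp X' \subset supp X :|: supp Y -> supp Y' \subset supp X :|: supp Y ->
    k \in supp X :|: supp Y -> X' k = None -> Y' k = None ->
    keeps_outside X' Y'.
  move=> X'M Y'M sX' sY' kXY X'k Y'k; apply: IHn => //.
  move: ltn; rewrite ltnS; apply: leq_trans; apply/proper_card/properP; split.
    by rewrite subUset sX'.
  by exists k; rewrite // !inE X'k Y'k.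
have sW := between_supp bW.
have [g [c [Xg Yg Wg]]] := elim_not_sub XM WM Xe We bW.
have oWg : opp W g = Some (~~ c) by rewrite oppE Wg.
have Ye0 : Y e <> None by rewrite Ye.
have oWe : opp W e = None by rewrite oppE We.
have oWM : opp W \in circuits M by rewrite circuit_opp_iff.
have oWf : opp W f = None by rewrite oppE Wf.
have fXY : f \in supp X :|: supp Y by rewrite !inE; case: eqP Xf.
have soW : supp (opp W) \subset supp X :|: supp Y by rewrite supp_flip.
have [Y1 [Y1M Y1g Y1e bY1]] :=
  IH Y (opp W) f YM oWM (subsetUr _ _) soW fXY Yf oWf _ _ _ Yg oWg Ye0 oWe.
have sY1 : supp Y1 \subset supp X :|: supp Y.
  by apply: subset_trans (between_supp bY1) _; rewrite subUset subsetUr.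
have gXY : g \in supp X :|: supp Y by rewrite !inE Yg orbT.
have Y1f : Y1 f = None by case: (bY1 f) => ->.
rewrite Ye in Y1e.
have [Z [ZM Ze Zf bZ]] :=
  IH X Y1 g XM Y1M (subsetUl _ _) sY1 gXY Xg Y1g _ _ _ Xe Y1e Xf Y1f.
apply: (repair WM bW We Wf _ ZM Ze Xf Zf).
  move=> Z' Z'M Z'e sZ'.
  apply: (IH _ _ e) => //.
  by rewrite !inE Xe.
move=> h; case: (bZ h) => ->; [by constructor 1 | by constructor 2 |].
by case: (bY1 h) => ->; [constructor 1 | constructor 3 | constructor 4].
Qed.

(** When [f] lies in [Y] as well, the same construction applies: the
    eliminations against [W], which misses [e] and [f], are those of the
    previous lemma, and only the one between [X] and [Y1] is inductive. *)
Lemma strong_elim X Y e f b c : X \in circuits M -> Y \in circuits M ->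
  X e = Some b -> Y e = Some (~~ b) -> X f = Some c -> Y f <> Some (~~ c) ->
  exists Z, [/\ Z \in circuits M, Z e = None, Z f = Some c & between X Y Z].
Proof.
have [n] := ubnP #|supp X :|: supp Y|.
elim: n Y => // n IHn Y ltn XM YM Xe Ye Xf Yf.
have Xf0 : X f <> None by rewrite Xf.
have [Yf0|Yf0] := eqVneq (Y f) None.
  by rewrite -Xf; apply: (strong_elim_outside XM YM Xe).
have {Yf0}Yf : Y f = Some c by move: Yf Yf0; case: (Y f) => [[]|] //; case: (c).
have nXY : X <> opp Y by move=> eX; move: Xf; rewrite eX oppE Yf; case: (c).
have [W [WM We bW]] := weak_elim XM YM nXY Xe Ye.
have [Wf|Wf] := eqVneq (W f) None; last first.
  by exists W; split=> //; case: (bW f) => eW; rewrite eW // in Wf *.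
have [g [k [Xg Yg Wg]]] := elim_not_sub XM WM Xe We bW.
have oWg : opp W g = Some (~~ k) by rewrite oppE Wg.
have Ye0 : Y e <> None by rewrite Ye.
have oWe : opp W e = None by rewrite oppE We.
have oWM : opp W \in circuits M by rewrite circuit_opp_iff.
have [Y1 [Y1M Y1g Y1e bY1]] := strong_elim_outside YM oWM Yg oWg Ye0 oWe.
rewrite Ye in Y1e.
have Y1f : Y1 f <> Some (~~ c).
  by case: (bY1 f) => ->; rewrite ?Yf ?oppE ?Wf //; case: (c).
have sY1 : supp Y1 \subset supp X :|: supp Y.
  apply: subset_trans (between_supp bY1) _; rewrite subUset subsetUr supp_flip.
  exact: between_supp.
have lt1 : #|supp X :|: supp Y1| < n.
  move: ltn; rewrite ltnS; apply: leq_trans; apply/proper_card/properP; split.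
    by rewrite subUset subsetUl.
  by exists g; rewrite !inE ?Yg ?orbT ?Xg ?Y1g.
have [Z [ZM Ze Zf bZ]] := IHn Y1 lt1 XM Y1M Xe Y1e Xf Y1f.
rewrite -Xf in Zf *.
apply: (repair WM bW We Wf _ ZM Ze Xf0 Zf) => [Z' Z'M _ _|h].
  exact: strong_elim_outside.
case: (bZ h) => ->; [by constructor 1 | by constructor 2 |].
by case: (bY1 h) => ->; [constructor 1 | constructor 3 | constructor 4].
Qed.

End Elimination.

(** * Closure and rank *)

Section Rank.
Variables (E : finType) (M : oriented_matroid E).
Implicit Types (A B I J : {set E}) (X Y Z : signed E) (e f : E).

Definition cl A : {set E} :=
  [set e | (e \in A) ||
           [exists X in circuits M, (X e != None) && (supp X \subset e |: A)]].

Lemma clP e A : reflect (e \in A \/ exists X, [/\ X \in circuits M,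
  X e != None & supp X \subset e |: A]) (e \in cl A).
Proof.
rewrite inE; apply: (iffP orP) => -[eA|].
- by left.
- by case/exists_inP=> X XM /andP[Xe sX]; right; exists X.
- by left.
- by case=> X [XM Xe sX]; right; apply/exists_inP; exists X; rewrite ?Xe.
Qed.

Lemma sub_cl A : A \subset cl A.
Proof. by apply/subsetP=> e eA; apply/clP; left. Qed.

Lemma clS A B : A \subset B -> cl A \subset cl B.
Proof.
move=> sAB; apply/subsetP=> e /clP[eA|[X [XM Xe sX]]]; apply/clP.
  by left; apply: (subsetP sAB).
by right; exists X; split=> //; apply: subset_trans sX (setUS _ sAB).
Qed.

Lemma circuit_sign X e b : X \in circuits M -> X e != None ->
  exists Y, [/\ Y \in circuits M, Y e = Some b & supp Y = supp X].
Proof.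
move=> XM; case Xe: (X e) => [c|] // _.
have [->|ncb] := eqVneq b c; first by exists X.
exists (opp X); rewrite circuit_opp_iff oppE Xe supp_flip; split=> //=.
by case: b c ncb {Xe} => [] [].
Qed.

(** Transitivity of the closure: the elements of [X] outside [A] are eliminated
    one by one with circuits that have no other element outside [A]. *)
Lemma cl_circuit X e A : X \in circuits M -> X e != None ->
  supp X \subset e |: cl A -> e \in cl A.
Proof.
have [n] := ubnP #|supp X :\: (e |: A)|.
elim: n X => // n IHn X; rewrite ltnS => ltn XM Xe sX.
have [eA|neA] := boolP (e \in A); first by apply: (subsetP (sub_cl A)).
have [X0|[f]] := set_0Vmem (supp X :\: (e |: A)).
  apply/clP; right; exists X; split=> //.
  by rewrite -setD_eq0 X0.
rewrite in_setD in_setU1 negb_or => /andP[/andP[nfe nfA] fX].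
have /clP[fA|[Y [YM Yf sY]]] : f \in cl A.
- by have := subsetP sX f fX; rewrite in_setU1 (negPf nfe).
- by rewrite fA in nfA.
move: fX; rewrite inE; case Xf: (X f) => [b|] // _.
have [Y' [Y'M Y'f sY']] := circuit_sign (~~ b) YM Yf.
have Ye : Y' e = None.
  apply/eqP; rewrite -[_ == _]negbK -in_supp sY'; apply/negP=> eY.
  by have := subsetP sY e eY; rewrite !inE eq_sym (negPf nfe) (negPf neA).
have Xe0 : X e <> None by apply/eqP.
have [Z [ZM Zf Ze bZ]] := strong_elim_outside XM Y'M Xf Y'f Xe0 Ye.
have sZ : supp Z \subset supp X :|: supp Y by rewrite -sY' between_supp.
apply: (IHn Z) => //; last 2 first.
- by rewrite Ze.
- apply: subset_trans sZ _; rewrite subUset sX /=.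
  apply: subset_trans sY _; rewrite subUset sub1set; apply/andP; split.
    by apply: (subsetP sX); rewrite inE Xf.
  exact: subset_trans (sub_cl A) (subsetUr _ _).
apply: leq_trans ltn; apply/proper_card/properP; split; last first.
  by exists f; rewrite !inE ?Xf ?(negPf nfe) ?(negPf nfA) // Zf.
apply/subsetP=> h; rewrite !in_setD => /andP[nhA hZ]; rewrite nhA.
have /setUP[//|hY] := subsetP sZ h hZ.
have := subsetP sY h hY; rewrite in_setU1 => /orP[/eqP eh|hA].
  by move: hZ; rewrite eh inE Zf.
by rewrite in_setU1 hA orbT in nhA.
Qed.

Lemma cl_sub A B : A \subset cl B -> cl A \subset cl B.
Proof.
move=> sAB; apply/subsetP=> e /clP[eA|[X [XM Xe sX]]].
  exact: (subsetP sAB).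
by apply: cl_circuit XM Xe _; apply: subset_trans sX (setUS _ sAB).
Qed.

Lemma indepP I :
  reflect (forall e, e \in I -> e \notin cl (I :\ e)) (indep M I).
Proof.
apply: (iffP forall_inP) => [indI e eI|indI X XM].
  apply/clP=> -[|[X [XM Xe]]]; first by rewrite !inE eqxx.
  by rewrite setD1K // => sX; have := indI X XM; rewrite sX.
apply/negP=> sX; have [e eX] := set0Pn _ (circuit_neq0 XM).
have eI := subsetP sX e eX; have /clP[] := indI e eI; right.
by exists X; rewrite -in_supp eX setD1K.
Qed.

Lemma indepS I J : I \subset J -> indep M J -> indep M I.
Proof.
move=> sIJ /forall_inP indJ; apply/forall_inP=> X XM.
by apply: contra (indJ X XM) => sX; apply: subset_trans sX sIJ.
Qed.

Lemma indep0 : indep M set0.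
Proof. by apply/indepP=> e; rewrite inE. Qed.

Lemma indepU1 I e : indep M I -> e \notin cl I -> indep M (e |: I).
Proof.
move=> /forall_inP indI neI; apply/forall_inP=> X XM; apply/negP=> sX.
have [Xe|Xe] := eqVneq (X e) None.
  have /negP[] := indI X XM; apply/subsetP=> f fX.
  have := subsetP sX f fX; rewrite in_setU1 => /orP[/eqP ef|//].
  by move: fX; rewrite ef inE Xe.
by case/clP: neI; right; exists X.
Qed.

(** Steinitz exchange: an element of [I] outside the spanning set [J] is
    replaced by an element of [J]. *)
Lemma indep_span_card I J : indep M I -> I \subset cl J -> #|I| <= #|J|.
Proof.
have [n] := ubnP #|I :\: J|; elim: n I => // n IHn I; rewrite ltnS => ltn indI.
have [sIJ|] := boolP (I \subset J); first by rewrite subset_leq_card.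
case/subsetPn=> e eI neJ sI.
have nJ : ~~ (J \subset cl (I :\ e)).
  apply/negP=> /cl_sub/subsetP/(_ e) ecl; have /indepP/(_ e eI)/negP[] := indI.
  exact/ecl/(subsetP sI).
case/subsetPn: nJ => f fJ nf.
have nfI : f \notin I :\ e by apply: contra nf => /(subsetP (sub_cl _)).
have -> : #|I| = #|f |: (I :\ e)| by rewrite cardsU1 nfI [LHS](cardsD1 e) eI.
apply: IHn.
- apply: leq_trans ltn; apply/proper_card/properP; split; last first.
    have nef : e != f by apply: contraNneq neJ => ->.
    by exists e; rewrite !inE ?eI ?neJ // eqxx (negPf nef).
  apply/subsetP=> h; rewrite !inE => /andP[hJ /orP[/eqP eh|/andP[_ ->]]].
    by rewrite eh fJ in hJ.
  by rewrite hJ.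
- by apply: indepU1 nf; apply: indepS indI; apply: subsetDl.
- rewrite subUset sub1set (subsetP (sub_cl J)) //=.
  by apply: subset_trans sI; apply: subsetDl.
Qed.

Lemma rank_max I A : I \subset A -> indep M I -> #|I| <= rank M A.
Proof.
move=> sI indI; apply: (@bigop.leq_bigmax_cond _ _ (fun I : {set E} => #|I|)).
by rewrite sI.
Qed.

Lemma basis_exists A :
  exists J, [/\ J \subset A, indep M J, #|J| = rank M A & A \subset cl J].
Proof.
pose P := [pred I : {set E} | (I \subset A) && indep M I].
have P0 : 0 < #|P|.
  by apply/card_gt0P; exists set0; rewrite inE sub0set indep0.
have [J] := eq_bigmax_cond (fun I : {set E} => #|I|) P0.
rewrite inE => /andP[sJ indJ] eJ.
exists J; split=> //; apply/subsetP=> e eA.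
apply/negPn/negP=> ne; have indeJ := indepU1 indJ ne.
have neJ : e \notin J by apply: contra ne => /(subsetP (sub_cl J)).
have := @rank_max (e |: J) A; rewrite subUset sub1set eA sJ indeJ.
by rewrite cardsU1 neJ /rank eJ ltnn => /(_ isT isT).
Qed.

Lemma rank_span A B : A \subset cl B -> rank M A <= rank M B.
Proof.
move=> sAB; have [J [_ _ <- sBJ]] := basis_exists B.
have [I [sI indI <- _]] := basis_exists A.
apply: indep_span_card indI _.
exact: subset_trans sI (subset_trans sAB (cl_sub sBJ)).
Qed.

Lemma rankS A B : A \subset B -> rank M A <= rank M B.
Proof. by move=> sAB; apply: rank_span (subset_trans sAB (sub_cl B)). Qed.

Lemma rankU1 e A : rank M (e |: A) = rank M A + (e \notin cl A).
Proof.
have [ecl|necl] := boolP (e \in cl A); rewrite ?addn0 ?addn1.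
  apply/eqP; rewrite eqn_leq (rankS (subsetUr _ _)) rank_span //.
  by rewrite subUset sub1set ecl sub_cl.
apply/eqP; rewrite eqn_leq; apply/andP; split.
  have [I [sI indI <- _]] := basis_exists (e |: A).
  rewrite (cardsD1 e) -addn1 addnC leq_add ?leq_b1 // rank_max //.
    by rewrite subDset.
  by apply: indepS indI; apply: subsetDl.
have [J [sJ indJ <- sAJ]] := basis_exists A.
have neJ : e \notin cl J by apply: contra necl; apply/subsetP/clS.
have neJ' : e \notin J by apply: contra neJ => /(subsetP (sub_cl J)).
have <- : #|e |: J| = #|J|.+1 by rewrite cardsU1 neJ'.
by apply: rank_max (indepU1 indJ neJ); rewrite setUS.
Qed.

Lemma rank0 : rank M set0 = 0.
Proof.
have [J [sJ _ <- _]] := basis_exists set0.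
by move: sJ; rewrite subset0 => /eqP->; rewrite cards0.
Qed.

End Rank.

(** * Positive cocircuits and circuits *)

Section Farkas.
Variables (E : finType) (M : oriented_matroid E).
Implicit Types (D L Z : {set E}) (X Y C : signed E) (e f g : E).

Definition pos_signed D : signed E :=
  [ffun e => if e \in D then Some true else None].

Lemma supp_pos_signed D : supp (pos_signed D) = D.
Proof. by apply/setP=> e; rewrite inE ffunE; case: ifP. Qed.

Lemma positive_pos_signed D : positive (pos_signed D).
Proof.
by rewrite /positive; apply/eqP/setP=> e; rewrite !inE ffunE; case: ifP.
Qed.

Lemma positiveP X :
  reflect (forall e, X e <> Some false) (positive X).
Proof.
apply: (iffP eqP) => [nX e Xe|nX].
  by move/setP/(_ e): nX; rewrite !inE Xe.
by apply/setP=> e; rewrite !inE; apply/negbTE/eqP/nX.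
Qed.

Lemma cocircuit_neq0 X : X \in cocircuits M -> supp X != set0.
Proof.
rewrite inE => /andP[/minsetp lt_r _]; apply/eqP=> X0.
by rewrite X0 setC0 ltnn in lt_r.
Qed.

(** Such a circuit excludes any positive cocircuit through [e] that avoids
    [L], by orthogonality; Farkas' lemma is the converse. *)
Definition obstructed L e :=
  [exists C in circuits M, (C e == Some true) && (neg C \subset L)].

Lemma obstructedP L e : reflect
  (exists C, [/\ C \in circuits M, C e = Some true & neg C \subset L])
  (obstructed L e).
Proof.
apply: (iffP exists_inP) => [[C CM /andP[/eqP Ce nC]]|[C [CM Ce nC]]].
  by exists C.
by exists C; rewrite // Ce eqxx.
Qed.

Lemma poscocircuit_not_obstructed X L e : X \in cocircuits M -> positive X ->
  e \in supp X -> [disjoint supp X & L] -> ~~ obstructed L e.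
Proof.
rewrite inE => /andP[_ /forall_inP orthX] /positiveP posX eX dXL.
apply/obstructedP=> -[C [CM Ce nC]].
have Xpos f : f \in supp X -> X f = Some true.
  by rewrite inE; have := posX f; case: (X f) => [[]|].
case/orP: (orthX C CM) => [/eqP/setP/(_ e)|/andP[_ /exists_inP[f]]].
  by rewrite in_setI eX !inE Ce.
rewrite in_setI => /andP[fX]; rewrite (Xpos f fX) inE.
case Cf: (C f) => [[]|] // _ _.
have fL : f \in L by apply: (subsetP nC); rewrite inE Cf.
by have /pred0P/(_ f) := dXL; rewrite /= fX fL.
Qed.

(** For a maximal unobstructed set [Z], the complement of [Z] is shown to be a
    positive cocircuit. *)
Section MaximalObstruction.

Variables (Z : {set E}) (e : E).
Hypotheses (eZ : e \notin Z) (nZ : ~~ obstructed Z e).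
Hypothesis (maxZ : forall f, f \notin Z -> f != e -> obstructed (f |: Z) e).

(** By maximality there is a circuit through [e] whose only negative element
    off [Z] is [f]; eliminating [f] between the two circuits would obstruct
    [Z]. *)
Lemma circuit_pos_off C f : C \in circuits M -> C f = Some true ->
  f \notin Z -> ~~ (neg C \subset Z).
Proof.
move=> CM Cf nfZ; apply/negP=> nC.
have [efe|nfe] := eqVneq f e.
  by case/obstructedP: nZ; exists C; rewrite -efe.
have /obstructedP[D [DM De nD]] := maxZ nfZ nfe.
have Df : D f = Some false.
  apply/eqP; rewrite -in_neg; apply: contraNT nZ => nDf.
  apply/obstructedP; exists D; split=> //.
  apply/subsetP=> h hD; have := subsetP nD h hD.
  by rewrite in_setU1 => /orP[/eqP eh|//]; rewrite -eh hD in nDf.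
have Ce : C e <> Some false.
  by move=> Ce; case/negP: eZ; apply: (subsetP nC); rewrite inE Ce.
have [W [WM Wf We bW]] := strong_elim DM CM Df Cf De Ce.
case/obstructedP: nZ; exists W; split=> //.
apply/subsetP=> h; rewrite inE => /eqP Wh.
case: (bW h) => eW; rewrite eW // in Wh.
  have : h \in neg D by rewrite inE Wh.
  move/(subsetP nD); rewrite in_setU1 => /orP[/eqP eh|//].
  by rewrite -eW eh Wf in Wh.
by apply: (subsetP nC); rewrite inE Wh.
Qed.

(** Geometrically, after a contraction of [Z], maximality says that each [f]
    lies in the convex hull of the other points, so that [e] is the only
    extreme point.  One by one, the other points [g] are removed from the
    expressions of all [f], by means of the expression of [g] itself. *)
Lemma circuit_two_off f : f \notin Z -> f != e -> exists C,
  [/\ C \in circuits M, C e = Some true, C f = Some false &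
      supp C \subset [set e; f] :|: Z].
Proof.
suff IH (S : {set E}) : S \subset ~: (e |: Z) ->
    forall f, f \notin Z -> f != e ->
    exists C, [/\ C \in circuits M, C e = Some true, C f = Some false,
      neg C \subset f |: Z & supp C :&: S \subset [set f]].
  move=> nfZ nfe.
  have [C [CM Ce Cf nC sC]] := IH (~: (e |: Z)) (subxx _) f nfZ nfe.
  exists C; split=> //; apply/subsetP=> h hC.
  rewrite !inE; case: eqVneq => //= nhe; case: (boolP (h \in Z)).
    by rewrite orbT.
  move=> nhZ; have /(subsetP sC) : h \in supp C :&: ~: (e |: Z).
    by rewrite in_setI hC in_setC in_setU1 negb_or nhe.
  by rewrite inE => ->.
have [n] := ubnP #|S|; elim: n S => // n IHn S; rewrite ltnS => ltn sS.
have [->|[g gS]] := set_0Vmem S => {}f nfZ nfe.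
  have /obstructedP[C [CM Ce nC]] := maxZ nfZ nfe.
  exists C; split; rewrite ?setI0 ?sub0set //.
  apply/eqP; rewrite -in_neg; apply: contraNT nZ => nCf.
  apply/obstructedP; exists C; split=> //.
  apply/subsetP=> h hC; have := subsetP nC h hC.
  by rewrite in_setU1 => /orP[/eqP eh|//]; rewrite -eh hC in nCf.
have ltS : #|S :\ g| < n.
  by apply: leq_trans ltn; rewrite [X in _ < X](cardsD1 g) gS.
have {}IHn := IHn _ ltS (subset_trans (subsetDl _ _) sS).
have [C [CM Ce Cf nC sC]] := IHn f nfZ nfe.
have sC' h : h \in S -> h != g -> C h != None -> h = f.
  move=> hS nhg Ch; have := subsetP sC h; rewrite !inE Ch hS nhg.
  by move/(_ isT)/eqP.
have [Cg|Cg] := eqVneq (C g) None.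
  exists C; split=> //; apply/subsetP=> h.
  rewrite in_setI in_supp in_set1 => /andP[Ch hS].
  apply/eqP/sC' => //; apply: contraNneq Ch => ->.
  by rewrite Cg.
have [egf|ngf] := eqVneq g f.
  exists C; split=> //; apply/subsetP=> h.
  rewrite in_setI in_supp in_set1 => /andP[Ch hS].
  have [->|nhg] := eqVneq h g; first by rewrite egf.
  by apply/eqP/sC'.
have := subsetP sS g gS; rewrite !inE negb_or => /andP[nge ngZ].
have {}Cg : C g = Some true.
  move: Cg; case eCg: (C g) => [[]|] // _.
  have := subsetP nC g; rewrite !inE eCg (negPf ngf) (negPf ngZ).
  by move/(_ isT).
have [D [DM De Dg nD sD]] := IHn g ngZ nge.
have De' : D e <> Some false by rewrite De.
have [W [WM Wg We bW]] := strong_elim CM DM Cg Dg Ce De'.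
have nW : neg W \subset f |: Z.
  apply/subsetP=> h; rewrite inE => /eqP Wh.
  case: (bW h) => eW; rewrite eW // in Wh.
    by apply: (subsetP nC); rewrite inE Wh.
  have : h \in neg D by rewrite inE Wh.
  move/(subsetP nD); rewrite !in_setU1 => /orP[/eqP eh|->]; last exact: orbT.
  by rewrite -eW eh Wg in Wh.
exists W; split=> //.
  apply/eqP; rewrite -in_neg; apply: contraNT nZ => nWf.
  apply/obstructedP; exists W; split=> //.
  apply/subsetP=> h hW; have := subsetP nW h hW.
  by rewrite in_setU1 => /orP[/eqP eh|//]; rewrite -eh hW in nWf.
apply/subsetP=> h; rewrite in_setI in_supp in_set1 => /andP[Wh hS].
have [ehg|nhg] := eqVneq h g; first by rewrite ehg Wg in Wh.
case: (bW h) => eW; rewrite eW // in Wh.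
  by apply/eqP/sC'.
have := subsetP sD h; rewrite !inE Wh hS nhg => /(_ isT).
by rewrite (negPf nhg).
Qed.

Lemma rank_maximal : rank M Z < rank M [set: E].
Proof.
have <- : rank M (e |: Z) = (rank M Z).+1.
  rewrite rankU1 (_ : _ \notin _) ?addn1 //.
  apply/clP=> -[|[C [CM Ce sC]]]; first by apply/negP.
  have [C' [C'M C'e sC']] := circuit_sign true CM Ce.
  case/obstructedP: nZ; exists C'; split=> //; apply/subsetP=> h hC.
  have : h \in supp C by move: hC; rewrite -sC' !inE => /eqP->.
  move/(subsetP sC); rewrite in_setU1 => /orP[/eqP eh|//].
  by move: hC; rewrite eh inE C'e.
exact: rankS (subsetT _).
Qed.

(** Any two elements off [Z] span each other together with [Z]. *)
Lemma rank_maximalU1 f : f \notin Z -> rank M (f |: Z) = rank M [set: E].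
Proof.
move=> nfZ.
have clE g h A C : C \in circuits M -> C h != None ->
    supp C \subset [set g; h] :|: Z -> g |: Z \subset cl M A -> h \in cl M A.
  move=> CM Ch sC sA; apply: cl_circuit CM Ch _.
  apply: subset_trans sC _; rewrite setUAC setUC setUS //.
have sf : f |: Z \subset cl M (f |: Z) := sub_cl _ _.
have efcl : e \in cl M (f |: Z).
  have [<-|nfe] := eqVneq f e; first by rewrite (subsetP sf) ?setU11.
  have [C [CM Ce Cf sC]] := circuit_two_off nfZ nfe.
  by apply: clE CM _ _ sf; rewrite ?Ce // [X in X :|: _]setUC.
have se : e |: Z \subset cl M (f |: Z).
  by rewrite subUset sub1set efcl (subset_trans (subsetUr _ _) sf).
apply/eqP; rewrite eqn_leq rankS ?subsetT //= rank_span //.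
apply/subsetP=> h _; have [hZ|nhZ] := boolP (h \in Z).
  by apply: (subsetP sf); rewrite !inE hZ orbT.
have [->//|nhe] := eqVneq h e.
have [C [CM Ce Ch sC]] := circuit_two_off nhZ nhe.
by apply: clE CM _ sC se; rewrite Ch.
Qed.

Lemma maximal_cocircuit : pos_signed (~: Z) \in cocircuits M.
Proof.
rewrite inE supp_pos_signed; apply/andP; split.
  apply/minsetP; rewrite setCK; split; first exact: rank_maximal.
  move=> D ltD sD; apply/eqP; rewrite eqEsubset sD /=.
  apply/subsetP=> f; rewrite inE => nfZ; apply: contraLR ltD => nfD.
  rewrite -leqNgt -(rank_maximalU1 nfZ) rankS // subUset sub1set inE nfD /=.
  by rewrite -(setCK Z) setCS.
apply/forall_inP=> C CM; rewrite /orthogonal supp_pos_signed.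
have [->//|[f]] := set_0Vmem (~: Z :&: supp C); first by rewrite eqxx.
have off C' g : C' \in circuits M -> g \notin Z -> C' g = Some true ->
    exists h, h \notin Z /\ C' h = Some false.
  move=> C'M ngZ C'g; have /subsetPn[h] := circuit_pos_off C'M C'g ngZ.
  by rewrite inE => /eqP C'h nhZ; exists h.
rewrite in_setI in_setC => /andP[nfZ fC]; apply/orP; right.
have [g [h [Cg Ch ngZ nhZ]]] : exists g h,
    [/\ C g = Some true, C h = Some false, g \notin Z & h \notin Z].
  move: fC; rewrite inE; case Cf: (C f) => [[]|] // _.
    by have [h [nhZ Ch]] := off C f CM nfZ Cf; exists f, h.
  have [||h [nhZ]] := off (opp C) f _ nfZ; rewrite ?circuit_opp_iff // oppE.
    by rewrite Cf.
  by case Ch: (C h) => [[]|] // _; exists h, f.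
apply/andP; split; apply/exists_inP; [exists g|exists h];
  by rewrite ?in_setI ?ffunE ?in_setC ?ngZ ?nhZ ?inE ?Cg ?Ch.
Qed.

End MaximalObstruction.

Lemma farkas L e : e \notin L -> ~~ obstructed L e ->
  exists X, [/\ X \in cocircuits M, positive X, e \in supp X &
                [disjoint supp X & L]].
Proof.
move=> neL nL; pose P Z := (e \notin Z) && ~~ obstructed Z e.
have PL : P L by rewrite /P neL nL.
have [Z /maxsetP[/andP[neZ nZ] maxZ] sLZ] := maxset_exists PL.
exists (pos_signed (~: Z)).
rewrite supp_pos_signed positive_pos_signed in_setC neZ.
split=> //; last by rewrite disjoints_subset setCS.
apply: maximal_cocircuit nZ _ => // f nfZ nfe; apply: contraNT nfZ => nfo.
have <- : f |: Z = Z; last by rewrite setU11.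
by apply: maxZ; rewrite ?subsetUr // /P in_setU1 negb_or eq_sym nfe neZ.
Qed.

Lemma farkasP L e : reflect
  (exists X, [/\ X \in cocircuits M, positive X, e \in supp X &
                [disjoint supp X & L]])
  ((e \notin L) && ~~ obstructed L e).
Proof.
apply: (iffP andP) => [[]|[X [XM pX eX dX]]]; first exact: farkas.
split; last exact: poscocircuit_not_obstructed dX.
by have /pred0P/(_ e)/= := dX; rewrite eX => /= ->.
Qed.

End Farkas.

(** * Perspectives and reorientations *)

Section Perspective.
Variable E : finType.
Implicit Types (M N : oriented_matroid E) (A B : {set E}) (X Y : signed E).

(** Conformal unions are only needed locally: one circuit of [N] at a time,
    through a given element. *)
Definition refines M N := forall X e, X \in circuits M -> X e <> None ->
  exists Y, [/\ Y \in circuits N, Y e = X e &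
                forall h, Y h = None \/ Y h = X h].

Lemma perspective_refines M N : perspective M N -> refines M N.
Proof.
move=> /subsetP MN X e XM Xe; have := MN X XM; rewrite inE.
case/existsP=> S /and4P[/subsetP SN /forall_inP confS /eqP posX /eqP negX].
have sub_X C h b : C \in S -> C h = Some b -> X h = Some b.
  move=> CS Ch; case: b Ch => Ch; apply/eqP.
    by rewrite -in_pos posX; apply/bigcupP; exists C; rewrite // in_pos Ch.
  by rewrite -in_neg negX; apply/bigcupP; exists C; rewrite // in_neg Ch.
suff [C CS Ce] : exists2 C, C \in S & C e = X e.
  exists C; split; rewrite ?SN // => h; case Ch: (C h) => [b|]; last by left.
  by right; rewrite (sub_X _ _ _ CS Ch).
case eX: (X e) Xe => [[]|] // _.
  have : e \in pos X by rewrite in_pos eX.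
  by rewrite posX => /bigcupP[C CS]; rewrite in_pos => /eqP; exists C.
have : e \in neg X by rewrite in_neg eX.
by rewrite negX => /bigcupP[C CS]; rewrite in_neg => /eqP; exists C.
Qed.

Lemma circuits_reorient A M X :
  (X \in circuits (reorient A M)) = (flip A X \in circuits M).
Proof. exact: in_reorient. Qed.

Lemma flip_val A X e b :
  (flip A X e == Some b) = (X e == Some (b (+) (e \in A))).
Proof.
by rewrite flipE; case: (e \in A); case: (X e) b => [[]|] [].
Qed.

Lemma flip_None A X e : (flip A X e == None) = (X e == None).
Proof. by rewrite flipE; case: (e \in A); case: (X e). Qed.

Lemma refines_reorient A M N :
  refines M N -> refines (reorient A M) (reorient A N).
Proof.
move=> MN X e; rewrite circuits_reorient => XM Xe.
have [|Y [YN Ye sY]] := MN _ e XM.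
  by apply/eqP; rewrite flip_None; apply/eqP.
exists (flip A Y); rewrite circuits_reorient flipK; split=> //.
  by rewrite -[in RHS](flipK A X) [LHS]flipE [RHS]flipE Ye.
move=> h; case: (sY h) => eY; [left|right].
  by apply/eqP; rewrite flip_None eY.
by rewrite -[in RHS](flipK A X) [LHS]flipE [RHS]flipE eY.
Qed.

End Perspective.

(** * States between orientations and subsets *)

Section States.
Variables (d : Order.disp_t) (E : finOrderType d).
Variables (M N : oriented_matroid E).
Hypothesis MN : refines M N.
Implicit Types (U A : {set E}) (X Y C : signed E) (e h w : E).

(** A state is a pair [(U, A)].  An element outside [U] carries a sign, namely
    minus when it lies in [A]; an element of [U] is contracted when it lies in
    [A] and deleted otherwise.  So [fits U A X h] says that [X] is allowed
    to take the value [X h] at [h]. *)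
Definition fits U A X h :=
  if X h is Some s then (if h \in U then h \in A else s == (h \notin A))
  else true.

(** The own state of [e] is ignored once [e] has lost its sign: then activity
    is that of a loop, or of a coloop, in a minor. *)
Definition through U A e X :=
  (X e != None) &&
  [forall h, (e <= h)%O ==> (((h == e) && (e \in U)) || fits U A X h)].

Definition none_below e X := [forall h, (h < e)%O ==> (X h == None)].

Definition act U A e :=
  [exists X in circuits M, through U A e X && none_below e X].

(** By Farkas' lemma, this is the negation of being dual-active: a circuit of
    [N] may be arbitrary below [e]. *)
Definition blocked U A e := [exists X in circuits N, through U A e X].

Lemma throughP U A e X : reflect
  (X e <> None /\
   forall h, (e <= h)%O -> (h = e /\ e \in U) \/ fits U A X h)
  (through U A e X).
Proof.
apply: (iffP andP) => [[/eqP Xe /forallP fX]|[Xe fX]]; split=> //.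
- move=> h eh; have := fX h; rewrite eh /=.
  by case/orP=> [/andP[/eqP]|]; [left|right].
- exact/eqP.
- apply/forallP=> h; apply/implyP=> /fX[[-> ->]|->]; first by rewrite eqxx.
  exact: orbT.
Qed.

Lemma none_belowP e X :
  reflect (forall h, (h < e)%O -> X h = None) (none_below e X).
Proof.
apply: (iffP forallP) => [fX h he|fX h].
  by have := fX h; rewrite he => /eqP.
by apply/implyP=> /fX/eqP.
Qed.

Lemma eq_through U U' A A' e X :
  (forall h, (e <= h)%O -> (h \in U) = (h \in U') /\ (h \in A) = (h \in A')) ->
  through U A e X = through U' A' e X.
Proof.
move=> eqUA; rewrite /through; congr (_ && _).
apply: eq_forallb => h; case: (boolP (e <= h)%O) => //= eh.
have [eU _] := eqUA e (lexx e); have [hU hA] := eqUA h eh.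
by rewrite /fits eU hU hA.
Qed.

(** The two notions are treated together, [b = true] standing for active
    elements in [M], and [b = false] for blocked elements in [N]. *)
Definition reached b U A e := if b then act U A e else blocked U A e.

Definition matroid_of b := if b then M else N.

Lemma reachedP b U A e : reflect
  (exists X, [/\ X \in circuits (matroid_of b), through U A e X &
                 b -> none_below e X])
  (reached b U A e).
Proof.
case: b; apply: (iffP exists_inP).
- by case=> X XM /andP[tX nX]; exists X.
- by case=> X [XM tX nX]; exists X; rewrite ?tX ?nX.
- by case=> X XM tX; exists X.
- by case=> X [XM tX nX]; exists X.
Qed.

(** So no element is both active and dual-active: a circuit of [M] contains a
    circuit of [N] through [e]. *)
Lemma act_blocked U A e : act U A e -> blocked U A e.
Proof.
case/exists_inP=> X XM /andP[/throughP[Xe fX] _].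
have [Y [YN Ye sY]] := MN XM Xe.
apply/exists_inP; exists Y => //; apply/throughP; split; first by rewrite Ye.
move=> h /fX[|fXh]; [by left | right].
by rewrite /fits; case: (sY h) => ->.
Qed.

Section Step.

Variables (U A : {set E}) (w : E).
Hypotheses (defU : forall h, (h \in U) = (w < h)%O) (nwA : w \notin A).

(** The four states of [w] are described by [U] or [w |: U] together with [A]
    or [w |: A]. *)
Definition same_off U' A' := forall h, (h == w) = false ->
  (h \in U') = (h \in U) /\ (h \in A') = (h \in A).

Lemma reached_above b U' A' e : same_off U' A' -> (w < e)%O ->
  reached b U' A' e = reached b U A e.
Proof.
move=> sUA we; have eqt X : through U' A' e X = through U A e X.
  apply: eq_through => h eh; apply: sUA.
  by apply: gt_eqF; apply: lt_le_trans we eh.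
by case: b; apply: eq_existsb => X; rewrite eqt.
Qed.

(** The state of [w] does not matter for [w] itself: if [w] carries a sign, a
    circuit may be replaced by its opposite, because no greater element has a
    sign. *)
Lemma reached_at b U' A' : same_off U' A' ->
  (reached b U' A' w <-> exists X,
  [/\ X \in circuits (matroid_of b), X w <> None,
     forall h, (w < h)%O -> X h <> None -> h \in A & b -> none_below w X]).
Proof.
move=> sUA; split=> [/reachedP[X [XM /throughP[Xw fX] nX]]|].
  exists X; split=> // h wh Xh.
  have [hU hA] := sUA h (gt_eqF wh).
  case: (fX h (ltW wh)) => [[eh _]|]; first by rewrite eh ltxx in wh.
  by rewrite /fits hU defU wh hA; case: (X h) Xh.
case=> X [XM Xw fX nX]; apply/reachedP.
case eXw: (X w) Xw => [s|] // _.
have [c fw] : exists c, forall Y : signed E,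
    Y w = Some c -> fits U' A' Y w \/ w \in U'.
  exists (w \notin A') => Y Yw; rewrite /fits Yw.
  case: ifP => _; first by right.
  by rewrite eqxx; left.
have [|Y [YM Yw sY]] := circuit_sign c XM (e := w); first by rewrite eXw.
have supY h : (Y h == None) = (X h == None).
  by apply: negb_inj; rewrite -!in_supp sY.
exists Y; split=> //; last first.
  move/nX/none_belowP=> nX'; apply/none_belowP=> h hw.
  by apply/eqP; rewrite supY nX'.
apply/throughP; rewrite Yw; split=> // h.
rewrite le_eqVlt eq_sym => /orP[/eqP->|wh].
  by case: (fw Y Yw); [right|left].
have [hU hA] := sUA h (gt_eqF wh); right.
rewrite /fits hU defU wh hA; case Yh: (Y h) => [t|] //; apply: fX => //.
by apply/eqP; rewrite -supY Yh.
Qed.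

Definition core e X := X e <> None /\
  forall h, (e <= h)%O -> h <> w -> fits U A X h.

(** The circuits that decide on [e] when the state of [w] is left open; the
    state then only restricts their value at [w]. *)
Definition item b e X :=
  [/\ X \in circuits (matroid_of b), core e X & b -> none_below e X].

Lemma eq_fits U' A' X Y h : X h = Y h -> fits U' A' X h = fits U' A' Y h.
Proof. by rewrite /fits => ->. Qed.

Lemma reached_below b U' A' e : same_off U' A' -> (e < w)%O ->
  (reached b U' A' e <-> exists2 X, item b e X & fits U' A' X w).
Proof.
move=> sUA ew; have neU : e \notin U' .
  by have [-> _] := sUA e (lt_eqF ew); rewrite defU -leNgt ltW.
have fE X h : h != w -> fits U' A' X h = fits U A X h.
  by move/negPf/sUA=> [hU hA]; rewrite /fits hU hA.
split=> [/reachedP[X [XM /throughP[Xe fX] nX]]|[X [XM [Xe fX] nX] fw]].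
  have {}fX h : (e <= h)%O -> fits U' A' X h.
    by move/fX => [[_ eU]|] //; rewrite eU in neU.
  exists X; last exact/fX/ltW.
  by split=> //; split=> // h eh /eqP nhw; rewrite -fE // fX.
apply/reachedP; exists X; split=> //; apply/throughP; split=> // h eh; right.
by have [->//|nhw] := eqVneq h w; rewrite fE // fX //; apply/eqP.
Qed.

(** The element [e] is kept because it carries a sign, which [X] and [Y] both
    respect unless [Y] misses [e]. *)
Lemma elim_item b X Y e s :
  X \in circuits (matroid_of b) -> Y \in circuits (matroid_of b) ->
  (e < w)%O -> core e X -> (forall h, (e <= h)%O -> h <> w -> fits U A Y h) ->
  (b -> none_below e X) -> (b -> none_below e Y) ->
  X w = Some s -> Y w = Some (~~ s) -> exists2 Z, item b e Z & Z w = None.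
Proof.
move=> XM YM ew [Xe fX] fY nX nY Xw Yw.
have new : e <> w by move=> eew; rewrite eew ltxx in ew.
case eXe: (X e) Xe => [c|] // _.
have neU : e \notin U by rewrite defU -leNgt ltW.
have Ye : Y e <> Some (~~ c).
  move=> eYe; have := fX e (lexx e) new; have := fY e (lexx e) new.
  by rewrite /fits eXe eYe (negPf neU) => /eqP<-; case: (c).
have [Z [ZM Zw Ze bZ]] := strong_elim XM YM Xw Yw eXe Ye.
exists Z => //; split=> //; first split.
- by rewrite Ze.
- move=> h eh nhw; case: (bZ h) => eZ; first by rewrite /fits eZ.
    by rewrite (eq_fits _ _ eZ) fX.
  by rewrite (eq_fits _ _ eZ) fY.
- move=> bt; apply/none_belowP=> h he.
  have /none_belowP/(_ h he) Xh := nX bt.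
  have /none_belowP/(_ h he) Yh := nY bt.
  by case: (bZ h) => ->.
Qed.

(** Two circuits that need [w] with opposite signs can be eliminated at [w]
    while one of the two elements they go through is kept.  For two circuits of
    [M] it is the smaller one, since neither circuit has an element below it;
    for two circuits of [N] it is the greater one, since both respect all signs
    above it.  In the mixed case, a circuit of [N] inside that of [M] respects
    all signs, and the element of the circuit of [N] is kept. *)
Lemma item_consistent b b' e e' X Y s : (e < w)%O -> (e' < w)%O ->
  item b e X -> item b' e' Y -> X w = Some s -> Y w = Some (~~ s) ->
  (exists2 Z, item b e Z & Z w = None) \/
  (exists2 Z, item b' e' Z & Z w = None).
Proof.
have none_fits Z e1 e2 : none_below e1 Z -> core e1 Z ->
    forall h, (e2 <= h)%O -> h <> w -> fits U A Z h.
  move=> /none_belowP nZ [_ fZ] h _ nhw; have [/fZ->//|he] := leP e1 h.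
  by rewrite /fits nZ.
have none_le Z e1 e2 : (e2 <= e1)%O -> none_below e1 Z -> none_below e2 Z.
  move=> le21 /none_belowP nZ; apply/none_belowP=> h h2.
  exact/nZ/(lt_le_trans h2).
have mixed Z W e1 e2 t : (e1 < w)%O -> (e2 < w)%O -> item true e1 Z ->
    item false e2 W -> Z w = Some t -> W w = Some (~~ t) ->
    exists2 Z', item false e2 Z' & Z' w = None.
  move=> lt1 lt2 [ZM cZ nZ] [WN cW _] Zw Ww.
  have [|Z' [Z'N Z'w sZ]] := MN ZM (e := w); first by rewrite Zw.
  apply: (@elim_item false W Z' e2 (~~ t)) => //; last by rewrite Z'w negbK.
  move=> h eh nhw; case: (sZ h) => eZ; first by rewrite /fits eZ.
  by rewrite (eq_fits _ _ eZ); apply: none_fits (nZ isT) cZ _ eh nhw.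
move=> ew e'w; case: b b' => [] [] iX iY Xw Yw.
- have [XM cX nX] := iX; have [YM cY nY] := iY.
  have /orP[le|le] := le_total e e'; [left|right].
    apply: (elim_item XM YM ew cX _ nX _ Xw Yw) => [|_].
      exact: none_fits (nY isT) cY.
    exact: none_le (nY isT).
  have Xw' : X w = Some (~~ ~~ s) by rewrite negbK.
  apply: (elim_item YM XM e'w cY _ nY _ Yw Xw') => [|_].
    exact: none_fits (nX isT) cX.
  exact: none_le (nX isT).
- by right; apply: mixed iX iY Xw Yw.
- by left; apply: mixed iY iX Yw _; rewrite ?Xw ?negbK.
have [XM cX nX] := iX; have [YM cY nY] := iY.
have /orP[le|le] := le_total e e'; [right|left].
  apply: (elim_item YM XM e'w cY _ nY _ Yw) => //; last by rewrite Xw negbK.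
  by move=> h eh; apply: (proj2 cX); apply: le_trans eh.
apply: (elim_item XM YM ew cX _ nX _ Xw Yw) => //.
by move=> h eh; apply: (proj2 cY); apply: le_trans eh.
Qed.

(** If [w] is active, it is a loop after the contractions, and it can be
    eliminated from any circuit by means of that loop; if [w] is dual-active,
    it is a coloop after the deletions, and no circuit that respects the states
    contains it. *)
Lemma item_degenerate b e X : (e < w)%O -> act U A w || ~~ blocked U A w ->
  item b e X -> exists2 Z, item b e Z & Z w = None.
Proof.
move=> ew actw iX; case Xw: (X w) => [s|]; last by exists X.
have [XM cX nX] := iX; have Xw0 : X w <> None by rewrite Xw.
have same0 : same_off U A by [].
have [Y [YM Yw Yabove nY]] : exists Y, [/\ Y \in circuits (matroid_of b),
    Y w = Some (~~ s), forall h, (w < h)%O -> Y h <> None -> h \in A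
    & forall h, (h < w)%O -> Y h = None].
  suff [Y [YM Yw Yab nY]] : exists Y, [/\ Y \in circuits (matroid_of b),
      Y w <> None, forall h, (w < h)%O -> Y h <> None -> h \in A
      & none_below w Y].
    have [|Z [ZM Zw sZ]] := circuit_sign (~~ s) YM (e := w); first exact/eqP.
    have supZ h : (Z h == None) = (Y h == None).
      by apply: negb_inj; rewrite -!in_supp sZ.
    exists Z; split=> // h hw.
      by move/eqP; rewrite supZ => /eqP; apply: Yab.
    by apply/eqP; rewrite supZ (none_belowP _ _ nY).
  case/orP: actw => [/(reached_at true same0)[Y [YM Yw Yab nY]]|nb].
    case: (b); first by exists Y; split=> //; apply: nY.
    have [Z [ZN Zw sZ]] := MN YM Yw.
    exists Z; split=> //; first by rewrite Zw.
      by move=> h wh Zh; apply: Yab => //; case: (sZ h) => eZ //; rewrite -eZ.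
    apply/none_belowP=> h hw; have /none_belowP/(_ h hw) Yh := nY isT.
    by case: (sZ h) => ->.
  case/negP: nb; apply/(reached_at false same0).
  have [Z [ZN Zw sZ]] : exists Z, [/\ Z \in circuits N, Z w = X w &
       forall h, Z h = None \/ Z h = X h].
    case: (b) XM => XM; first exact: MN.
    by exists X; split=> // h; right.
  exists Z; split=> //; first by rewrite Zw.
  move=> h wh Zh; have [_ fX] := cX.
  have eh : (e <= h)%O by rewrite ltW // (lt_trans ew).
  have nhw : h <> w by move=> ehw; rewrite ehw ltxx in wh.
  have := fX h eh nhw; rewrite /fits defU wh.
  by case: (sZ h) Zh => -> //; case: (X h).
apply: (elim_item XM YM ew cX _ nX _ Xw Yw) => [h eh nhw|_].
  have [hw|wh|//] := ltgtP h w; first by rewrite /fits nY.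
  rewrite /fits defU wh; case Yh: (Y h) => [c|] //.
  by apply: Yabove; rewrite ?Yh.
by apply/none_belowP=> h he; apply: nY; apply: lt_trans he ew.
Qed.

End Step.
End States.

(** * The activity expansion *)

Lemma set_min (d : Order.disp_t) (E : finOrderType d) (A : {set E}) e :
  e \in A -> exists2 m, m \in A & forall h, h \in A -> (m <= h)%O.
Proof.
move=> eA; case: (@arg_minP _ E E e (mem A) id eA) => m mA min_m.
by exists m.
Qed.

Section StepCases.
Variables (d : Order.disp_t) (E : finOrderType d).
Variables (M N : oriented_matroid E).
Hypothesis MN : refines M N.
Variables (U A : {set E}) (w : E).
Hypotheses (defU : forall h, (h \in U) = (w < h)%O) (nwA : w \notin A).
Implicit Types (e : E) (b : bool).

Let wA := w |: A.
Let wU := w |: U.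

Let off_wA : same_off U A w U wA.
Proof. by move=> h nhw; rewrite in_setU1 nhw. Qed.
Let off_wU : same_off U A w wU A.
Proof. by move=> h nhw; rewrite in_setU1 nhw. Qed.
Let off_wUA : same_off U A w wU wA.
Proof. by move=> h nhw; rewrite !in_setU1 nhw. Qed.
Let off_id : same_off U A w U A. Proof. by []. Qed.

Let nwU : w \notin U. Proof. by rewrite defU ltxx. Qed.

Lemma step_fits (X : signed E) :
  [/\ fits U A X w = (X w != Some false), fits U wA X w = (X w != Some true),
      fits wU A X w = (X w == None) & fits wU wA X w].
Proof.
rewrite /fits !in_setU1 eqxx (negPf nwU) (negPf nwA) /=.
by split; case: (X w) => [[]|].
Qed.

Let belowP U' A' b e (off : same_off U A w U' A') (ew : (e < w)%O) :=
  @reached_below _ _ M N U A w defU b U' A' e off ew.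

Lemma deleted_plus b e : (e < w)%O ->
  reached M N b wU A e -> reached M N b U A e.
Proof.
move=> ew /(belowP _ off_wU ew)[X iX fX]; apply/(belowP _ off_id ew).
by exists X; move: fX => //; have [-> _ -> _] := step_fits X => /eqP->.
Qed.

Lemma deleted_minus b e : (e < w)%O ->
  reached M N b wU A e -> reached M N b U wA e.
Proof.
move=> ew /(belowP _ off_wU ew)[X iX fX]; apply/(belowP _ off_wA ew).
by exists X; move: fX => //; have [_ -> -> _] := step_fits X => /eqP->.
Qed.

Lemma contracted_if b U' A' e : same_off U A w U' A' -> (e < w)%O ->
  reached M N b U' A' e -> reached M N b wU wA e.
Proof.
move=> off ew /(belowP _ off ew)[X iX _]; apply/(belowP _ off_wUA ew).
by exists X => //; have [_ _ _] := step_fits X.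
Qed.

Lemma contracted_signed b e : (e < w)%O ->
  reached M N b wU wA e -> reached M N b U A e || reached M N b U wA e.
Proof.
move=> ew /(belowP _ off_wUA ew)[X iX _].
case: (eqVneq (X w) (Some false)) => Xw; apply/orP; [right|left].
  apply/(belowP _ off_wA ew); exists X => //.
  by have [_ -> _ _] := step_fits X; rewrite Xw.
by apply/(belowP _ off_id ew); exists X => //; have [-> _ _ _] := step_fits X.
Qed.

(** The sign plus of [w] cannot be decisive for [e] while the sign minus is
    decisive for [e'], by [item_consistent]. *)
Lemma step_consistent b b' e e' : (e < w)%O -> (e' < w)%O ->
  reached M N b U A e -> ~~ reached M N b wU A e ->
  reached M N b' U wA e' -> reached M N b' wU A e'.
Proof.
have deleted X b1 e1 : (e1 < w)%O -> item M N U A w b1 e1 X -> X w = None ->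
    reached M N b1 wU A e1.
  move=> ew iX Xw; apply/(belowP _ off_wU ew); exists X => //.
  by have [_ _ -> _] := step_fits X; rewrite Xw.
move=> ew e'w /(belowP _ off_id ew)[X iX fX] nR.
case/(belowP _ off_wA e'w)=> Y iY fY.
have {fX}Xw : X w = Some true.
  move: fX; have [-> _ _ _] := step_fits X.
  by case Xw: (X w) => [[]|] //; case/negP: nR; apply: deleted Xw.
have [Yw|Yw] := eqVneq (Y w) None; first exact: deleted Yw.
have {fY}Yw : Y w = Some (~~ true).
  by move: fY Yw; have [_ -> _ _] := step_fits Y; case: (Y w) => [[]|].
case: (item_consistent MN defU ew e'w iX iY Xw Yw) => -[Z iZ Zw].
  by case/negP: nR; apply: deleted Zw.
exact: deleted Zw.
Qed.

(** Deletion of [w] allows the fewest circuits and contraction the most.  What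
    contraction allows, one of the signs allows; by consistency it is the same
    sign for all smaller elements, and the other sign allows nothing more than
    deletion does. *)
Lemma step_dichotomy :
  (forall b e, (e < w)%O ->
     reached M N b U A e = reached M N b wU wA e /\
     reached M N b U wA e = reached M N b wU A e) \/
  (forall b e, (e < w)%O ->
     reached M N b U A e = reached M N b wU A e /\
     reached M N b U wA e = reached M N b wU wA e).
Proof.
pose crit b e := reached M N b U A e && ~~ reached M N b wU A e.
have [/existsP[b0 /exists_inP[e0 e0w /andP[plus0 ndel0]]]|ncrit] :=
  boolP [exists b, [exists (e | (e < w)%O), crit b e]].
  left=> b e ew; split; apply/idP/idP; try exact: contracted_if.
  - move=> cont; case/orP: (contracted_signed ew cont) => // minus.
    exact/deleted_plus/(step_consistent e0w ew plus0 ndel0 minus).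
  - exact: step_consistent e0w ew plus0 ndel0.
  - exact: deleted_minus.
right=> b e ew; have eqp : reached M N b U A e = reached M N b wU A e.
  apply/idP/idP; last exact: deleted_plus.
  move=> plus; apply: contraNT ncrit => ndel; apply/existsP; exists b.
  by apply/exists_inP; exists e; rewrite // /crit plus ndel.
split=> //; apply/idP/idP; first exact: contracted_if.
case/(contracted_signed ew)/orP=> //; rewrite eqp; exact: deleted_minus.
Qed.

Lemma step_degenerate b U' A' e : act M U A w || ~~ blocked N U A w ->
  same_off U A w U' A' -> (e < w)%O ->
  reached M N b U' A' e = reached M N b wU A e.
Proof.
move=> degw off ew; apply/idP/idP.
  case/(belowP _ off ew)=> X iX _.
  have [Z iZ Zw] := item_degenerate MN defU ew degw iX.
  apply/(belowP _ off_wU ew); exists Z => //.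
  by have [_ _ -> _] := step_fits Z; rewrite Zw.
case/(belowP _ off_wU ew)=> X iX fX; apply/(belowP _ off ew); exists X => //.
by move: fX; have [_ _ -> _] := step_fits X; rewrite /fits => /eqP->.
Qed.

Lemma step_at b U' A' : same_off U A w U' A' ->
  reached M N b U' A' w = reached M N b U A w.
Proof.
move=> off; apply/idP/idP=> [/(reached_at M N defU b off)|
  /(reached_at M N defU b off_id)] H.
  exact/(reached_at M N defU b off_id).
exact/(reached_at M N defU b off).
Qed.

End StepCases.

Section Expansion.
Variables (d : Order.disp_t) (E : finOrderType d).
Variables (M N : oriented_matroid E).
Hypothesis MN : refines M N.
Variable R : comNzRingType.
Local Open Scope ring_scope.

(** [aw u x] and [dw u x] are the weights of an active and of a dual-active
    element, where [u] tells whether the element has lost its sign, and [x]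
    whether it belongs to [A].  Only the sums over [x] matter. *)
Variables aw dw : bool -> bool -> R.
Hypothesis aw_sum :
  aw true true + aw true false = aw false true + aw false false.
Hypothesis dw_sum :
  dw true true + dw true false = dw false true + dw false false.
Implicit Types (U A : {set E}) (w : E).

Definition element_weight u x p q : R :=
  (if p then aw u x else 1) * (if q then 1 else dw u x).

Definition state_factor U A e : R :=
  element_weight (e \in U) (e \in A) (act M U A e) (blocked N U A e).

Definition state_weight U A : R := \prod_e state_factor U A e.

Lemma sum_setU1 (F : {set E} -> R) w :
  \sum_A F A = \sum_(A : {set E} | w \notin A) (F A + F (w |: A)).
Proof.
rewrite (bigID (fun A : {set E} => w \in A)) /= addrC big_split /=.
congr (_ + _).
rewrite (reindex_onto (fun A => w |: A) (fun A => A :\ w)) /=; last first.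
  by move=> A wA; rewrite setD1K.
apply: eq_bigl => A; rewrite setU11 /=; apply/eqP/idP => [<-|nwA].
  by rewrite !inE eqxx.
by rewrite setU1K.
Qed.

(** If [w] is active or dual-active, the four states of [w] have the same effect
    on the other elements, and the sums of the weights of [w] agree; otherwise
    [w] has weight 1 and the states are matched by [step_dichotomy]. *)
Lemma step_weight U A w : (forall h, (h \in U) = (w < h)%O) -> w \notin A ->
  state_weight U A + state_weight U (w |: A) =
  state_weight (w |: U) A + state_weight (w |: U) (w |: A).
Proof.
move=> defU nwA.
have off_id : same_off U A w U A by [].
have off_wA : same_off U A w U (w |: A).
  by move=> h nhw; rewrite in_setU1 nhw.
have off_wU : same_off U A w (w |: U) A.
  by move=> h nhw; rewrite in_setU1 nhw.
have off_wUA : same_off U A w (w |: U) (w |: A).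
  by move=> h nhw; rewrite !in_setU1 nhw.
have nwU : w \notin U by rewrite defU ltxx.
pose rest U' A' := \prod_(e | e != w) state_factor U' A' e.
pose p := act M U A w; pose q := blocked N U A w.
have splitw U' A' : same_off U A w U' A' -> state_weight U' A' =
    element_weight (w \in U') (w \in A') p q * rest U' A'.
  move=> off; rewrite /state_weight (bigD1 w) //=; congr (_ * _).
  have := step_at M N defU true off; have := step_at M N defU false off.
  by rewrite /state_factor /= => -> ->.
have eq_rest U1 A1 U2 A2 : same_off U A w U1 A1 -> same_off U A w U2 A2 ->
    (forall b e, (e < w)%O -> reached M N b U1 A1 e = reached M N b U2 A2 e) ->
    rest U1 A1 = rest U2 A2.
  move=> off1 off2 eqb; apply: eq_bigr => e new.
  have [eU1 eA1] := off1 e (negPf new); have [eU2 eA2] := off2 e (negPf new).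
  have eqr b : reached M N b U1 A1 e = reached M N b U2 A2 e.
    have [ew|we|ew] := ltgtP e w; first exact: eqb.
      by rewrite (reached_above M N b off1 we) (reached_above M N b off2 we).
    by rewrite ew eqxx in new.
  have := eqr true; have := eqr false.
  by rewrite /state_factor /= eU1 eA1 eU2 eA2 => -> ->.
rewrite !splitw // !setU11 (negPf nwU) (negPf nwA) /element_weight.
have degen : p || ~~ q -> [/\ rest U A = rest (w |: U) A,
    rest U (w |: A) = rest (w |: U) A &
    rest (w |: U) (w |: A) = rest (w |: U) A].
  by move=> pq; split; apply: eq_rest => // b e ew; apply: step_degenerate.
case eq_p: p degen => [|] degen.
  have -> : q by apply: act_blocked MN _ _ _ eq_p.
  have [-> -> ->] := degen isT.
  by rewrite !mulr1 -!mulrDl addrC -aw_sum addrC.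
case eq_q: q degen => [|] degen.
  rewrite !mulr1 !mul1r.
  case: (step_dichotomy MN defU nwA) => eqr; rewrite 1?addrC.
    rewrite (@eq_rest U A (w |: U) (w |: A))
            ?(@eq_rest U (w |: A) (w |: U) A) //.
    - by move=> b e /(eqr b e)[].
    - by move=> b e /(eqr b e)[].
  rewrite addrC; congr (_ + _); apply: eq_rest => // b e /(eqr b e)[] //.
have [-> -> ->] := degen isT.
by rewrite !mul1r -!mulrDl addrC -dw_sum addrC.
Qed.

Lemma sum_state_weight U : (forall h k, h \in U -> (h <= k)%O -> k \in U) ->
  \sum_A state_weight U A = \sum_A state_weight set0 A.
Proof.
have [n] := ubnP #|U|; elim: n U => // n IHn U; rewrite ltnS => ltn upU.
have [->//|[e eU]] := set_0Vmem U.
have [w wU minw] := set_min eU.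
have defU h : (h \in U :\ w) = (w < h)%O.
  rewrite in_setD1 lt_neqAle eq_sym; case: eqVneq => //= _.
  by apply/idP/idP=> [/minw|/(upU w)->].
rewrite -(IHn (U :\ w)); first last.
- by move=> h k; rewrite !defU; apply: lt_le_trans.
- by apply: leq_trans ltn; rewrite [X in (_ < X)%N](cardsD1 w) wU.
rewrite !(sum_setU1 _ w); apply: eq_bigr => A nwA.
by rewrite (step_weight defU nwA) setD1K.
Qed.

End Expansion.

(** * Positive circuits and cocircuits above a threshold *)

Section Above.
Variables (d : Order.disp_t) (E : finOrderType d).
Implicit Types (M N : oriented_matroid E) (A C : {set E}) (X : signed E).
Implicit Types (F : {set {set E}}) (e h t : E).

Definition above F t : {set E} := \bigcup_(C in F | min_ge t C) C.

Definition mins F : {set E} := [set e | [exists C in F, is_min e C]].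

Lemma min_geP t C : reflect
  (C != set0 /\ forall h, h \in C -> (t <= h)%O) (min_ge t C).
Proof.
apply: (iffP existsP) => [[m /andP[/andP[mC /forall_inP minC] tm]]|[]].
  split; first by apply/set0Pn; exists m.
  by move=> h hC; apply: le_trans tm (minC h hC).
case/set0Pn=> e eC tC; have [m mC minC] := set_min eC.
exists m; rewrite tC // andbT /is_min mC /=; exact/forall_inP.
Qed.

Lemma aboveP F e t : reflect
  (exists C, [/\ C \in F, e \in C & forall h, h \in C -> (t <= h)%O])
  (e \in above F t).
Proof.
apply: (iffP bigcupP) => [[C /andP[CF /min_geP[_ tC]] eC]|[C [CF eC tC]]].
  by exists C.
exists C => //; rewrite CF; apply/min_geP; split=> //.
by apply/set0Pn; exists e.
Qed.

Lemma mem_mins F e : (e \in mins F) = (e \in above F e).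
Proof.
rewrite inE; apply/exists_inP/aboveP => [[C CF /andP[eC /forall_inP minC]]|].
  by exists C.
by case=> C [CF eC minC]; exists C; rewrite // /is_min eC; apply/forall_inP.
Qed.

Lemma above_ge F e t : e \in above F t -> (t <= e)%O.
Proof. by case/aboveP=> C [_ eC tC]; apply: tC. Qed.

Lemma above_mins F e t : e \in above F t ->
  exists g, [/\ g \in mins F, (t <= g)%O & e \in above F g].
Proof.
case/aboveP=> C [CF eC tC]; have [m mC minC] := set_min eC.
exists m; split; [|exact: tC|by apply/aboveP; exists C].
by rewrite mem_mins; apply/aboveP; exists C.
Qed.

Lemma le_above F s t : (s <= t)%O -> above F t \subset above F s.
Proof.
move=> st; apply/subsetP=> e /aboveP[C [CF eC tC]]; apply/aboveP.
by exists C; split=> // h /tC; apply: le_trans.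
Qed.

Lemma above_circuitsP M e t : reflect
  (exists X, [/\ X \in circuits M, positive X, X e <> None &
                 forall h, X h <> None -> (t <= h)%O])
  (e \in above (poscircuits M) t).
Proof.
apply: (iffP (aboveP _ _ _)) => [[C [/imsetP[X]]]|[X [XM pX Xe tX]]].
  rewrite inE => /andP[XM pX] ->; rewrite inE => Xe tX; exists X; split=> //.
    exact/eqP.
  by move=> h /eqP Xh; apply: tX; rewrite inE.
exists (supp X); split; last by move=> h; rewrite inE => /eqP; apply: tX.
  by apply/imsetP; exists X; rewrite // inE XM.
by rewrite inE; apply/eqP.
Qed.

Lemma above_cocircuitsX M e t : reflect
  (exists X, [/\ X \in cocircuits M, positive X, e \in supp X &
                 forall h, h \in supp X -> (t <= h)%O])
  (e \in above (poscocircuits M) t).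
Proof.
apply: (iffP (aboveP _ _ _)) => [[C [/imsetP[X]]]|[X [XM pX Xe tX]]].
  by rewrite inE => /andP[XM pX] -> eX tX; exists X.
by exists (supp X); split=> //; apply/imsetP; exists X; rewrite // inE XM.
Qed.

(** Farkas' lemma turns positive cocircuits into a condition on circuits. *)
Lemma above_cocircuitsE M e t : (e \in above (poscocircuits M) t) =
  (t <= e)%O && ~~ obstructed M [set h | (h < t)%O] e.
Proof.
have -> : (t <= e)%O = (e \notin [set h | (h < t)%O]) by rewrite inE leNgt.
apply/above_cocircuitsX/farkasP => -[X [XM pX eX tX]]; exists X; split=> //.
  rewrite disjoints_subset; apply/subsetP=> h hX.
  by rewrite !inE -leNgt tX.
move=> h hX; move: tX; rewrite disjoints_subset => /subsetP/(_ h hX).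
by rewrite !inE -leNgt.
Qed.

Lemma poscircuits_neq0 M C : C \in poscircuits M -> C != set0.
Proof. by case/imsetP=> X; rewrite inE => /andP[/circuit_neq0 ? _] ->. Qed.

Lemma poscocircuits_neq0 M C : C \in poscocircuits M -> C != set0.
Proof. by case/imsetP=> X; rewrite inE => /andP[/cocircuit_neq0 ? _] ->. Qed.

Lemma mins_eq0 F : (forall C, C \in F -> C != set0) ->
  (F == set0) = (mins F == set0).
Proof.
move=> F0; apply/eqP/eqP => [->|mins0].
  by apply/setP=> e; rewrite !inE; apply/existsP=> -[C]; rewrite inE.
apply/setP=> C; rewrite inE; apply/negbTE/negP=> CF.
have /set0Pn[e eC] := F0 C CF; have [m mC minC] := set_min eC.
move/setP/(_ m): mins0; rewrite mem_mins inE => /aboveP[].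
by exists C.
Qed.

Lemma acyclicE M : acyclic M = (active M == set0).
Proof. exact/mins_eq0/poscircuits_neq0. Qed.

Lemma totally_cyclicE M : totally_cyclic M = (dual_active M == set0).
Proof. exact/mins_eq0/poscocircuits_neq0. Qed.

(** The initial states are the reorientations. *)
Lemma act_signed M A e : act M set0 A e = (e \in active (reorient A M)).
Proof.
rewrite [RHS]mem_mins; apply/exists_inP/above_circuitsP.
  case=> X XM /andP[/throughP[Xe fX] /none_belowP nX].
  exists (flip A X); rewrite circuits_reorient flipK; split=> //.
  - apply/positiveP=> h /eqP; rewrite flip_val => /eqP Xh.
    have [eh|/nX] := leP e h; last by rewrite Xh.
    case: (fX h eh) => [[_]|]; first by rewrite inE.
    by rewrite /fits Xh inE; case: (h \in A).
  - by apply/eqP; rewrite flip_None; apply/eqP.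
  - move=> h /eqP; rewrite flip_None => /eqP Xh.
    by have [//|/nX] := leP e h.
case=> Y [YM /positiveP pY Ye eY]; rewrite circuits_reorient in YM.
exists (flip A Y) => //; apply/andP; split.
  apply/throughP; split; first by apply/eqP; rewrite flip_None; apply/eqP.
  move=> h _; right; rewrite /fits inE; case fYh: (flip A Y h) => [s|] //.
  move/eqP: fYh; rewrite flip_val; have := pY h.
  by case: (Y h) => [[]|] //= _; case: (h \in A) s => [] [].
apply/none_belowP=> h he; apply/eqP; rewrite flip_None; apply/eqP.
case Yh: (Y h) => [s|] //; have := eY h; rewrite Yh leNgt he /=.
by move=> H; have : false by apply: H.
Qed.

Lemma blocked_signed N A e :
  blocked N set0 A e = (e \notin dual_active (reorient A N)).
Proof.
rewrite [e \in _]mem_mins above_cocircuitsE lexx /= negbK.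
apply/exists_inP/obstructedP.
  case=> X XN /throughP[Xe fX]; exists (flip A X).
  rewrite circuits_reorient flipK; split=> //.
    apply/eqP; rewrite flip_val; case: (fX e (lexx e)) => [[_]|].
      by rewrite inE.
    by rewrite /fits inE; case: (X e) Xe => // s _ /eqP->.
  apply/subsetP=> h; rewrite inE flip_val => /eqP Xh; rewrite inE ltNge.
  apply/negP=> /fX[[_]|]; rewrite ?inE // /fits Xh inE.
  by case: (h \in A).
case=> Y [YN Ye nY]; rewrite circuits_reorient in YN.
exists (flip A Y) => //; apply/throughP; split.
  by apply/eqP; rewrite flip_None Ye.
move=> h eh; right; rewrite /fits inE; case fYh: (flip A Y h) => [s|] //.
have : h \notin neg Y by apply/negP=> /(subsetP nY); rewrite inE ltNge eh.
move/eqP: fYh; rewrite flip_val inE => /eqP->.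
by case: (h \in A) s => [] [].
Qed.

(** The final states are the subsets, with the activities of matroid
    closure. *)
Lemma act_subset M A e :
  act M setT A e = (e \in cl M (A :&: [set h | (e < h)%O])).
Proof.
apply/exists_inP/clP.
  case=> X XM /andP[/throughP[Xe fX] /none_belowP nX]; right; exists X.
  split=> //; first exact/eqP.
  apply/subsetP=> h; rewrite !inE.
  case: ltgtP => [eh|he|_] //; last by rewrite nX.
  case: (fX h (ltW eh)) => [[ehe]|]; first by rewrite ehe ltxx in eh.
  by rewrite /fits inE andbT; case: (X h) => // s ->; rewrite orbT.
case=> [|[X [XM Xe sX]]]; first by rewrite !inE ltxx andbF.
exists X => //; apply/andP; split.
  apply/throughP; split; first exact/eqP.
  move=> h eh; have := subsetP sX h; rewrite !inE /fits inE.
  case: (X h) => [s /(_ isT)|]; last by right.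
  by case/orP=> [/eqP|/andP[hA _]]; [left|right].
apply/none_belowP=> h he; apply/eqP; apply: contraTT he => Xh.
have := subsetP sX h; rewrite !inE Xh => /(_ isT)/orP[/eqP->|/andP[_ eh]].
  by rewrite ltxx.
by rewrite -leNgt ltW.
Qed.

Lemma blocked_subset N A e : blocked N setT A e =
  (e \in cl N ([set h | (h < e)%O] :|: (A :&: [set h | (e < h)%O]))).
Proof.
apply/exists_inP/clP.
  case=> X XN /throughP[Xe fX]; right; exists X; split=> //; first exact/eqP.
  apply/subsetP=> h; rewrite !inE; case: ltgtP => //= eh.
  case: (fX h (ltW eh)) => [[ehe]|]; first by rewrite ehe ltxx in eh.
  by rewrite /fits inE andbT; case: (X h) => // s ->; rewrite orbT.
case=> [|[X [XN Xe sX]]]; first by rewrite !inE ltxx andbF.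
exists X => //; apply/throughP; split; first exact/eqP.
move=> h eh; have := subsetP sX h; rewrite !inE /fits inE ltNge eh /=.
case: (X h) => [s /(_ isT)|]; last by right.
by case/orP=> [/eqP|/andP[hA _]]; [left|right].
Qed.

End Above.

(** * The Tutte polynomial *)

Section TutteExpansion.
Variables (d : Order.disp_t) (E : finOrderType d).
Implicit Types (M N : oriented_matroid E) (A B : {set E}) (e : E).

(** Nullity: when the elements of [A] are added in decreasing order, the active
    ones are those that do not increase the rank. *)
Lemma card_active_subset M A :
  #|A| = rank M A + #|[set e in A | act M setT A e]|.
Proof.
have [n] := ubnP #|A|; elim: n A => // n IHn A; rewrite ltnS => ltn.
have [->|[a aA]] := set_0Vmem A.
  rewrite rank0 cards0; apply/esym/eqP; rewrite cards_eq0.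
  by apply/eqP/setP=> e; rewrite !inE.
have [m mA minA] := set_min aA.
have eA : A = m |: A :\ m by rewrite setD1K.
have ltA : #|A :\ m| < n.
  by apply: leq_trans ltn; rewrite [X in _ < X](cardsD1 m) mA.
have aboveD e : m != e -> e \in A ->
    (A :\ m) :&: [set h | (e < h)%O] = A :&: [set h | (e < h)%O].
  move=> nme eAe; apply/setP=> h; rewrite !inE.
  by case: eqVneq => //= ->; rewrite ltNge minA // andbF.
have act_m : act M setT A m = (m \in cl M (A :\ m)).
  rewrite act_subset; congr (_ \in cl M _); apply/setP=> h; rewrite !inE.
  by case hA: (h \in A); rewrite ?andbF //= lt_neqAle minA // eq_sym.
have eS : [set e in A | act M setT A e] :\ m =
          [set e in A :\ m | act M setT (A :\ m) e].
  apply/setP=> e; rewrite !inE !act_subset; case: eqVneq => //= nem.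
  by case eAe: (e \in A) => //=; rewrite aboveD // eq_sym.
rewrite [LHS](cardsD1 m) mA (IHn _ ltA) [in rank M A]eA rankU1.
rewrite [X in _ = _ + X](cardsD1 m) eS inE mA act_m /=.
by case: (m \in cl M _); rewrite ?addn0 ?add0n ?add1n ?addn1 ?addnS.
Qed.

(** Corank: when the elements outside [A] are added to [A] in increasing order,
    the dual-active ones are those that increase the rank. *)
Lemma card_dual_active_subset N A : rank N setT =
  rank N A + #|[set e | (e \notin A) && ~~ blocked N setT A e]|.
Proof.
have [n] := ubnP #|~: A|; elim: n A => // n IHn A; rewrite ltnS => ltn.
have [A0|[a aA]] := set_0Vmem (~: A).
  have -> : A = setT by rewrite -[A]setCK A0 setC0.
  have -> : [set e | (e \notin [set: E]) && ~~ blocked N setT setT e] = set0.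
    by apply/setP=> e; rewrite !inE.
  by rewrite cards0 addn0.
have [m] := set_min aA; rewrite in_setC => nmA minA.
have ltA : #|~: (m |: A)| < n.
  apply: leq_trans ltn; apply/proper_card/properP; split.
    by rewrite setCS subsetUr.
  by exists m; rewrite !inE ?eqxx ?nmA.
have aboveU e : e != m -> e \notin A ->
    [set h | (h < e)%O] :|: ((m |: A) :&: [set h | (e < h)%O]) =
    [set h | (h < e)%O] :|: (A :&: [set h | (e < h)%O]).
  move=> nem neA; apply/setP=> h; rewrite !inE; case: eqVneq => //= ->.
  have -> // : (m < e)%O.
  by rewrite lt_neqAle eq_sym nem minA // in_setC.
have blocked_m : blocked N setT A m = (m \in cl N A).
  rewrite blocked_subset; congr (_ \in cl N _); apply/setP=> h; rewrite !inE.
  case: ltgtP => //= [hm|mh|->]; rewrite ?andbF ?andbT ?(negPf nmA) //.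
  by apply/esym; apply: contraTT hm => nhA; rewrite -leNgt minA // in_setC.
rewrite (IHn _ ltA) rankU1 [in RHS](cardsD1 m) inE nmA blocked_m /=.
have -> // : [set e | (e \notin A) && ~~ blocked N setT A e] :\ m =
  [set e | (e \notin m |: A) && ~~ blocked N setT (m |: A) e].
  apply/setP=> e; rewrite !inE !blocked_subset negb_or.
  by case: eqVneq => //= nem; case eAe: (e \in A) => //=; rewrite aboveU // eAe.
by rewrite addnA.
Qed.

Variable R : comNzRingType.
Local Open Scope ring_scope.

Lemma tutte_term M N A (x y : R) :
  (x - 1) ^+ (rank N setT - rank N A) * (y - 1) ^+ (#|A| - rank M A) =
  \prod_e ((if act M setT A e then if e \in A then y - 1 else 1 else 1) *
           (if blocked N setT A e then 1 else if e \in A then 1 else x - 1)).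
Proof.
rewrite (card_dual_active_subset N A) addKn.
rewrite {1}(card_active_subset M A) addKn mulrC big_split /=.
rewrite -!prodr_const [X in X * _]big_mkcond [X in _ * X]big_mkcond /=.
congr (_ * _); apply: eq_bigr => e _; rewrite inE.
  by case: (act _ _ _ _); rewrite ?andbT ?andbF.
by case: (blocked _ _ _ _); case: (e \in A).
Qed.

(** The weights of the signed elements are a, b, c, d0, and those of the
    contracted and deleted ones are chosen such that the final state sum is the
    definition of the Tutte polynomial: with x = a + b and y = c + d0, they are
    x - 1 for a deleted dual-active element, y - 1 for a contracted active one,
    and 1 in the other cases. *)
Theorem tutte_expansion M N (a b c d0 : R)
    (f : {rmorphism {mpoly int[3]} -> R}) : refines M N ->
  f 'X_(0 : 'I_3) = a + b -> f 'X_(1 : 'I_3) = c + d0 -> f 'X_(2 : 'I_3) = 1 ->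
  f (tutte M N) = \sum_(A : {set E}) \prod_e
    ((if e \in active (reorient A M) then if e \in A then d0 else c else 1) *
     (if e \in dual_active (reorient A N) then if e \in A then b else a
      else 1)).
Proof.
move=> MN f0 f1 f2.
pose aw u (x : bool) : R := if u then if x then c + d0 - 1 else 1
                            else if x then d0 else c.
pose dw u (x : bool) : R := if u then if x then 1 else a + b - 1
                            else if x then b else a.
have aw_sum : aw true true + aw true false = aw false true + aw false false.
  by rewrite /aw /= subrK addrC.
have dw_sum : dw true true + dw true false = dw false true + dw false false.
  by rewrite /dw /= [1 + _]addrC subrK addrC.
have sumT : \sum_A state_weight M N aw dw setT A = f (tutte M N).
  rewrite /tutte rmorph_sum; apply: eq_bigr => A _.
  rewrite !rmorphM !rmorphXn !rmorphB rmorph1 f0 f1 f2 expr1n mulr1.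
  rewrite tutte_term; apply: eq_bigr => e _.
  by rewrite /state_factor /element_weight inE.
rewrite -sumT (sum_state_weight MN aw_sum dw_sum); last first.
  by move=> h k; rewrite !inE.
apply: eq_bigr => A _; apply: eq_bigr => e _.
rewrite /state_factor /element_weight inE act_signed blocked_signed.
by congr (_ * _); case: (e \in dual_active _).
Qed.

End TutteExpansion.

(** * Reorienting unions of positive circuits or cocircuits *)

Section FlipInvariance.
Variables (d : Order.disp_t) (E : finOrderType d).
Implicit Types (M N : oriented_matroid E) (A B L : {set E}) (X C : signed E).
Implicit Types (e f h s t : E).

Lemma flip_symdiff A B X : flip B (flip A X) = flip (symdiff A B) X.
Proof.
apply/ffunP=> e; rewrite !flipE !inE.
by case: (e \in A); case: (e \in B); case: (X e) => //= b; rewrite ?negbK.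
Qed.

Lemma flip_disjoint B X : [disjoint supp X & B] -> flip B X = X.
Proof.
move=> dXB; apply/ffunP=> e; rewrite flipE; case: ifP => // eB.
have /pred0P/(_ e) := dXB; rewrite /= eB andbT inE => /negbFE/eqP->.
by [].
Qed.

Lemma circuits_reorient_sub B M X : X \in circuits M -> supp X \subset B ->
  X \in circuits (reorient B M).
Proof.
move=> XM sX; rewrite circuits_reorient.
suff -> : flip B X = opp X by rewrite circuit_opp_iff.
apply/ffunP=> e; rewrite !flipE inE; case: ifPn => // /(contra (subsetP sX e)).
by rewrite inE negbK => /eqP->.
Qed.

Lemma eq_poscircuits M1 M2 : circuits M1 = circuits M2 ->
  poscircuits M1 = poscircuits M2.
Proof. by rewrite /poscircuits => ->. Qed.

Lemma eq_poscocircuits M1 M2 : circuits M1 = circuits M2 ->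
  poscocircuits M1 = poscocircuits M2.
Proof.
move=> eqM; have eq_rank A : rank M1 A = rank M2 A.
  rewrite /rank; apply: eq_bigl => I; by rewrite /indep eqM.
have eq_min D : cocircuit_supp M1 D = cocircuit_supp M2 D.
  by rewrite /cocircuit_supp; apply: minset_eq => D'; rewrite !eq_rank.
have eqC : cocircuits M1 = cocircuits M2.
  by apply/setP=> X; rewrite !inE eq_min eqM.
by rewrite /poscocircuits eqC.
Qed.

Lemma circuits_reorient2 A B M :
  circuits (reorient B (reorient A M)) = circuits (reorient (symdiff A B) M).
Proof.
apply/setP=> X; rewrite !circuits_reorient flip_symdiff.
have -> // : symdiff B A = symdiff A B.
by apply/setP=> e; rewrite !inE orbC.
Qed.

Lemma circuits_reorientK B M :
  circuits (reorient B (reorient B M)) = circuits M.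
Proof. by apply/setP=> X; rewrite !circuits_reorient flipK. Qed.

(** In other words, [B] is a union of positive circuits. *)
Definition pos_covered M B := forall b, b \in B -> exists X,
  [/\ X \in circuits M, positive X, X b <> None & supp X \subset B].

Lemma positive_val X e : positive X -> X e <> None -> X e = Some true.
Proof. by move/positiveP/(_ e); case: (X e) => [[]|]. Qed.

(** Negative elements in a union of positive circuits are eliminated against
    these circuits. *)
Lemma clear_negative M B L C e : pos_covered M B -> e \notin B ->
  C \in circuits M -> C e = Some true -> neg C \subset B :|: L ->
  exists Z, [/\ Z \in circuits M, Z e = Some true, neg Z \subset L &
                supp Z \subset supp C :|: B].
Proof.
move=> covB neB; have [n] := ubnP #|neg C :\: L|.
elim: n C => // n IHn C; rewrite ltnS => ltn CM Ce nC.
have [nCL|[f]] := set_0Vmem (neg C :\: L).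
  by exists C; split; rewrite ?subsetUl // -setD_eq0 nCL.
rewrite in_setD => /andP[nfL fC]; have fB : f \in B.
  by have := subsetP nC f fC; rewrite in_setU (negPf nfL) orbF.
have [X [XM pX Xf sX]] := covB f fB.
have Xe : X e = None.
  apply/eqP; rewrite -[_ == _]negbK -in_supp.
  by apply: contra neB => /(subsetP sX).
have Cf : C f = Some false by move: fC; rewrite inE => /eqP.
have {}Xf : X f = Some (~~ false) by apply: positive_val.
have Ce0 : C e <> None by rewrite Ce.
have [Z [ZM Zf Ze bZ]] := strong_elim_outside CM XM Cf Xf Ce0 Xe.
have sZ : supp Z \subset supp C :|: B.
  exact: subset_trans (between_supp bZ) (setUS _ sX).
have nZ h : h \in neg Z -> h \in neg C.
  rewrite !inE => /eqP Zh; case: (bZ h) => eZ; rewrite eZ // in Zh.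
    by rewrite Zh.
  by have := positiveP _ pX h; rewrite Zh.
have [||||W [WM We nW sW]] := IHn Z.
- apply: leq_trans ltn; apply/proper_card/properP; split.
    by apply/subsetP=> h; rewrite !in_setD => /andP[-> /nZ].
  by exists f; rewrite !inE ?Cf ?Zf ?nfL.
- exact: ZM.
- by rewrite Ze.
- by apply/subsetP=> h /nZ/(subsetP nC).
exists W; split=> //; apply: subset_trans sW _.
by rewrite subUset sZ subsetUr.
Qed.

Notation G M t := (above (poscircuits M) t).
Notation D M t := (above (poscocircuits M) t).

Lemma G_covered M t : pos_covered M (G M t).
Proof.
move=> b /above_circuitsP[X [XM pX Xb tX]]; exists X; split=> //.
apply/subsetP=> h; rewrite inE => /eqP Xh; apply/above_circuitsP.
by exists X.
Qed.

Lemma pos_covered_flip M B : pos_covered M B -> pos_covered (reorient B M) B.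
Proof.
move=> covB b /covB[X [XM pX Xb sX]]; exists X; split=> //.
exact: circuits_reorient_sub.
Qed.

Lemma pos_covered_refines M N B :
  refines M N -> pos_covered M B -> pos_covered N B.
Proof.
move=> MN covB b /covB[X [XM pX Xb sX]]; have [Y [YN Yb sY]] := MN X b XM Xb.
exists Y; split=> //; last 2 first.
- by rewrite Yb.
- apply: subset_trans sX; apply/subsetP=> h; rewrite !inE.
  by case: (sY h) => ->.
- by apply/positiveP=> h; case: (sY h) => -> //; apply: positiveP.
Qed.

Lemma mem_G_clear M B e t C :
  pos_covered M B -> (forall b, b \in B -> (t <= b)%O) ->
  C \in circuits M -> C e = Some true -> neg C \subset B ->
  (forall h, C h <> None -> (t <= h)%O) -> e \notin B -> e \in G M t.
Proof.
move=> covB geB CM Ce nC geC neB.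
have nC0 : neg C \subset B :|: set0 by rewrite setU0.
have [Z [ZM Ze nZ sZ]] := clear_negative covB neB CM Ce nC0.
apply/above_circuitsP; exists Z; split; rewrite ?Ze //.
  by rewrite /positive -subset0.
move=> h /eqP Zh; have := subsetP sZ h; rewrite !inE Zh => /(_ isT).
by case/orP=> [/eqP/geC|/geB].
Qed.

Lemma neg_flip B X : neg X = set0 -> neg (flip B X) \subset B.
Proof.
move/setP=> nX; apply/subsetP=> h; rewrite in_neg_flip.
by case: ifP => // _; rewrite nX inE.
Qed.

Lemma G_flip_self M t : G (reorient (G M t) M) t \subset G M t.
Proof.
set B := G M t; apply/subsetP=> e /above_circuitsP[Y [YM pY Ye tY]].
apply: contraT => neB; rewrite -(negPf neB); rewrite circuits_reorient in YM.
apply: (@mem_G_clear _ B e t _ (@G_covered M t) _ YM) => //.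
- by move=> b; apply: above_ge.
- by rewrite flipE (negPf neB); apply: positive_val.
- exact/neg_flip/eqP.
- by move=> h /eqP; rewrite flip_None => /eqP/tY.
Qed.

(** If [t <= s], the circuits in question lie inside [B], and their opposites
    become positive.  If [s <= t], a positive circuit may lose positivity on
    [B] only, and [clear_negative] restores it without elements below [s]. *)
Lemma G_flip_sub M s t : G M s \subset G (reorient (G M t) M) s.
Proof.
set B := G M t; have covB : pos_covered (reorient B M) B.
  exact/pos_covered_flip/G_covered.
apply/subsetP=> e eG; have [eB|neB] := boolP (e \in B).
  have : e \in G M (Order.max s t) by rewrite /Order.max; case: ifP.
  case/above_circuitsP=> X [XM pX Xe tX]; apply/above_circuitsP; exists X.
  split=> //; last by move=> h /tX; rewrite ge_max => /andP[].
  apply: circuits_reorient_sub => //; apply/subsetP=> h; rewrite inE => /eqP Xh.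
  apply/above_circuitsP; exists X; split=> // k /tX.
  by rewrite ge_max => /andP[].
have st : (s <= t)%O.
  rewrite leNgt; apply: contra neB => /ltW/(le_above (poscircuits M))/subsetP.
  exact.
have /above_circuitsP[X [XM pX Xe sX]] := eG.
apply: (mem_G_clear covB _ (C := flip B X)) => //.
- by move=> b /above_ge; apply: le_trans.
- by rewrite circuits_reorient flipK.
- by rewrite flipE (negPf neB); apply: positive_val.
- exact/neg_flip/eqP.
- by move=> h /eqP; rewrite flip_None => /eqP/sX.
Qed.

(** A union of positive circuits of [M] is one of [N]; so a circuit of [N] that
    obstructs [e] after the reorientation of [B] can be cleared of its negative
    elements in [B], and obstructs [e] beforehand. *)
Lemma D_flip_sub M N B s : refines M N -> pos_covered M B ->
  D N s \subset D (reorient B N) s.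
Proof.
move=> MN covM; have covB := pos_covered_refines MN covM.
apply/subsetP=> e; rewrite !above_cocircuitsE => /andP[-> /=].
apply: contra => /obstructedP[C' [C'N C'e nC']]; apply/obstructedP.
have [eB|neB] := boolP (e \in B).
  have [X [XN pX Xe _]] := covB e eB; exists X; split=> //.
    exact: positive_val.
  by rewrite (eqP pX) sub0set.
rewrite circuits_reorient in C'N.
have [||Z [ZN Ze nZ _]] :=
  clear_negative (L := [set h | (h < s)%O]) covB neB C'N.
- by rewrite flipE (negPf neB).
- apply/subsetP=> h; rewrite in_setU in_neg_flip.
  by case: ifP => // _ /(subsetP nC').
by exists Z.
Qed.

(** The converse inclusion holds because reorientation is an involution. *)
Lemma G_flip M t s : G (reorient (G M t) M) s = G M s.
Proof.
have self : G (reorient (G M t) M) t = G M t.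
  by apply/eqP; rewrite eqEsubset G_flip_self G_flip_sub.
apply/eqP; rewrite eqEsubset G_flip_sub andbT.
have := G_flip_sub (reorient (G M t) M) s t; rewrite self.
by rewrite (eq_poscircuits (circuits_reorientK _ _)).
Qed.

Lemma D_flip_G M N t s : refines M N -> D (reorient (G M t) N) s = D N s.
Proof.
move=> MN; set B := G M t; have covB := @G_covered M t.
apply/eqP; rewrite eqEsubset (D_flip_sub s MN covB) andbT.
have := D_flip_sub s (refines_reorient (A:=B) MN) (pos_covered_flip covB).
by rewrite (eq_poscocircuits (circuits_reorientK _ _)).
Qed.

(** By orthogonality, a circuit that meets a union of positive cocircuits meets
    it in both signs. *)
Lemma D_not_obstructed N t e : e \in D N t -> ~~ obstructed N (~: D N t) e.
Proof.
case/above_cocircuitsX=> X [XN pX eX tX].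
apply: (poscocircuit_not_obstructed XN pX eX).
rewrite disjoints_subset setCK; apply/subsetP=> h hX.
by apply/above_cocircuitsX; exists X.
Qed.

Lemma D_flip_self N t : D (reorient (D N t) N) t \subset D N t.
Proof.
set B := D N t; apply/subsetP=> e; rewrite {1}above_cocircuitsE => /andP[te].
apply: contraNT => neB; move: (neB); rewrite above_cocircuitsE te negbK.
case/obstructedP=> C [CN Ce nC]; apply/obstructedP; exists C; split=> //.
rewrite circuits_reorient flip_disjoint //; apply/pred0P=> f /=.
apply/negbTE/negP=> /andP[Cf fB]; have /obstructedP[] := D_not_obstructed fB.
exists C; split=> //.
  move: Cf; rewrite inE; case eCf: (C f) => [[]|] // _.
  have := subsetP nC f; rewrite !inE eCf ltNge (above_ge fB).
  by move=> H; have := H isT.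
apply: subset_trans nC _; apply/subsetP=> h; rewrite !inE => ht.
by apply: contraL ht => /above_ge; rewrite -leNgt.
Qed.

(** A circuit that obstructs [e] after the reorientation has no negative element
    from [s] on.  If [e] lies in [B], this is excluded by orthogonality with
    the positive cocircuits inside [B]; otherwise [s <= t], so the circuit has
    a constant sign on [B], hence misses [B], and obstructs [e] beforehand. *)
Lemma D_flip_D_sub N s t : D N s \subset D (reorient (D N t) N) s.
Proof.
set B := D N t; apply/subsetP=> e eD.
rewrite above_cocircuitsE (above_ge eD) /=.
apply/obstructedP=> -[C' [C'N C'e nC']]; rewrite circuits_reorient in C'N.
(* A circuit C' positive at f and positive above s would be negative, before
   the reorientation, on all of a union of positive cocircuits containing f. *)
have bad f u : f \in D N u -> (s <= u)%O -> (t <= u)%O ->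
    C' f = Some true -> False.
  move=> fD su tu C'f; have /obstructedP[] := D_not_obstructed fD.
  exists (opp (flip B C')); rewrite circuit_opp_iff oppE flipE C'f.
  have sub_B h : h \in D N u -> h \in B by apply/subsetP/le_above.
  rewrite (sub_B _ fD); split=> //; apply/subsetP=> h; rewrite in_neg_flip inE.
  rewrite in_pos_flip in_setC; case: ifP => [hB hC|/negP nhB _]; last first.
    by apply/negP=> /sub_B.
  apply: contraTN (subsetP nC' h hC) => /above_ge uh.
  by rewrite inE -leNgt (le_trans su).
have [eB|neB] := boolP (e \in B).
  apply: (bad e (Order.max s t)); rewrite ?le_max ?lexx ?orbT //.
  by rewrite /Order.max; case: ifP.
have st : (s <= t)%O.
  rewrite leNgt; apply: contra neB => /ltW/(le_above (poscocircuits N))/subsetP.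
  exact.
have dC'B : [disjoint supp C' & B].
  apply/pred0P=> f /=; apply/negbTE/negP=> /andP[C'f fB].
  apply: (bad f t) => //; move: C'f; rewrite inE.
  case eC'f: (C' f) => [[]|] // _; have := subsetP nC' f; rewrite !inE eC'f.
  by rewrite ltNge (le_trans st (above_ge fB)) => /(_ isT).
move: eD; rewrite above_cocircuitsE => /andP[_ /obstructedP[]].
by rewrite (flip_disjoint dC'B) in C'N; exists C'.
Qed.

Lemma D_flip N t s : D (reorient (D N t) N) s = D N s.
Proof.
have self : D (reorient (D N t) N) t = D N t.
  by apply/eqP; rewrite eqEsubset D_flip_self D_flip_D_sub.
apply/eqP; rewrite eqEsubset D_flip_D_sub andbT.
have := D_flip_D_sub (reorient (D N t) N) s t; rewrite self.
by rewrite (eq_poscocircuits (circuits_reorientK _ _)).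
Qed.

Lemma disjoint_GD M N s t e : refines M N -> e \in G M s -> e \notin D N t.
Proof.
move=> MN eG; have [X [XN pX Xe _]] :=
  pos_covered_refines MN (@G_covered M s) eG.
rewrite above_cocircuitsE negb_and negbK; apply/orP; right; apply/obstructedP.
exists X; split=> //; first exact: positive_val.
by rewrite (eqP pX) sub0set.
Qed.

(** Positive circuits of [M] miss the positive cocircuits of [N]. *)
Lemma G_flip_D_sub M N t s : refines M N ->
  G M s \subset G (reorient (D N t) M) s.
Proof.
move=> MN; apply/subsetP=> e /above_circuitsP[X [XM pX Xe sX]].
apply/above_circuitsP; exists X; split=> //.
rewrite circuits_reorient flip_disjoint //; apply/pred0P=> f /=.
apply/negbTE/negP=> /andP[fX]; apply/negP; apply: (@disjoint_GD M N s) => //.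
apply/above_circuitsP; exists X; split=> //; apply/eqP.
by rewrite -in_supp.
Qed.

Lemma G_flip_D M N t s : refines M N -> G (reorient (D N t) M) s = G M s.
Proof.
move=> MN; apply/eqP; rewrite eqEsubset (G_flip_D_sub _ _ MN) andbT.
have := G_flip_D_sub t s (refines_reorient (A:=D N t) MN); rewrite D_flip.
by rewrite (eq_poscircuits (circuits_reorientK _ _)).
Qed.

End FlipInvariance.

(** * Unions of parts *)

Section Parts.
Variables (d : Order.disp_t) (E : finOrderType d).
Implicit Types (Phi : {ffun E -> {set E}}) (A B S : {set E}) (e g h s t : E).

(** What the unions of positive circuits and those of positive cocircuits above
    a threshold have in common; the parts only depend on them. *)
Record decreasing_family Phi : Prop := DecreasingFamily {
  family_ge : forall e t, e \in Phi t -> (t <= e)%O;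
  family_le : forall s t, (s <= t)%O -> Phi t \subset Phi s;
  family_start : forall e t, e \in Phi t ->
    exists g, [/\ g \in Phi g, (t <= g)%O & e \in Phi g]
}.

Definition starts Phi : {set E} := [set g | g \in Phi g].

(** The greatest [g] with [e] in [Phi g] is the index of the part of [e]. *)
Definition part Phi g : {set E} :=
  [set e in Phi g | [forall h in starts Phi, (g < h)%O ==> (e \notin Phi h)]].

Lemma partP Phi g e : reflect
  (e \in Phi g /\ forall h, h \in starts Phi -> (g < h)%O -> e \notin Phi h)
  (e \in part Phi g).
Proof.
rewrite inE; apply: (iffP andP) => -[eg /= maxg]; split=> //.
  by move=> h hPhi gh; have /forall_inP/(_ h hPhi) := maxg; rewrite gh.
by apply/forall_inP=> h hPhi; apply/implyP; apply: maxg.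
Qed.

Lemma part_start Phi g : decreasing_family Phi -> g \in starts Phi ->
  g \in part Phi g.
Proof.
move=> fPhi; rewrite inE => gg; apply/partP; split=> // h _.
by rewrite ltNge; apply/contra/family_ge.
Qed.

Lemma part_inj Phi g h e : g \in starts Phi -> h \in starts Phi ->
  e \in part Phi g -> e \in part Phi h -> g = h.
Proof.
move=> gS hS /partP[eg maxg] /partP[eh maxh].
by case: (ltgtP g h) => // [/(maxg h hS)|/(maxh g gS)]; rewrite ?eg ?eh.
Qed.

Lemma family_part Phi t e : decreasing_family Phi -> e \in Phi t ->
  exists2 g, g \in starts Phi & e \in part Phi g.
Proof.
move=> fPhi /(family_start fPhi)[g0 [g0S _ eg0]].
have g0P : (g0 \in starts Phi) && (e \in Phi g0) by rewrite inE g0S.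
have [g /andP[gS eg] maxg] :=
  @arg_maxP _ E E g0 [pred h | (h \in starts Phi) && (e \in Phi h)] id g0P.
exists g => //; apply/partP; split=> // h hS gh; apply/negP=> eh.
by have := maxg h; rewrite /= hS eh leNgt gh => /(_ isT).
Qed.

Lemma start_in_family Phi g t : decreasing_family Phi -> g \in starts Phi ->
  (g \in Phi t) = (t <= g)%O.
Proof.
move=> fPhi; rewrite inE => gS; apply/idP/idP; first exact: family_ge.
by move/(family_le fPhi)/subsetP/(_ g gS).
Qed.

Lemma part_in_family Phi g t e : decreasing_family Phi -> g \in starts Phi ->
  e \in part Phi g -> (e \in Phi t) = (g \in Phi t).
Proof.
move=> fPhi gS /partP[eg maxg]; rewrite (start_in_family t fPhi gS).
apply/idP/idP=> [/(family_start fPhi)[h [hS th eh]]|tg]; last first.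
  exact: (subsetP (family_le fPhi tg)).
apply: le_trans th _; rewrite leNgt; apply: contraL eh => gh.
by apply: maxg; rewrite ?inE.
Qed.

Section TwoFamilies.
Variables G D : {ffun E -> {set E}}.
Hypotheses (fG : decreasing_family G) (fD : decreasing_family D).
Hypothesis GD : forall e s t, e \in G s -> e \notin D t.

Definition Act := starts G :|: starts D.

Definition activity_part g := if g \in starts G then part G g else part D g.

(** The unions of parts ([saturated_cover]), in a form in which symmetric
    differences are immediate. *)
Definition saturated B :=
  [forall e in B, [exists g in Act, e \in activity_part g]] &&
  [forall g in Act, forall e in activity_part g, (e \in B) == (g \in B)].

Lemma saturatedP B : reflect
  ((forall e, e \in B -> exists2 g, g \in Act & e \in activity_part g) /\
   (forall g e, g \in Act -> e \in activity_part g -> (e \in B) = (g \in B)))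
  (saturated B).
Proof.
apply: (iffP andP) => -[].
  move=> /forall_inP covB /forall_inP satB; split.
    by move=> e /covB/exists_inP[g gA eg]; exists g.
  by move=> g e gA eg; have /forall_inP/(_ e eg)/eqP := satB g gA.
move=> covB satB; split; apply/forall_inP.
  by move=> e /covB[g gA eg]; apply/exists_inP; exists g.
by move=> g gA; apply/forall_inP=> e eg; rewrite (satB g).
Qed.

Lemma startsD_notG g : g \in starts D -> (g \in starts G) = false.
Proof. by rewrite !inE => gD; apply: contraTF gD => /GD. Qed.

Lemma ActP g : g \in Act ->
  (g \in starts G /\ activity_part g = part G g) \/
  (g \in starts D /\ activity_part g = part D g).
Proof.
rewrite /activity_part => /setUP[gG|gD]; first by rewrite gG; left.
by rewrite startsD_notG //; right.
Qed.

Lemma activity_part_start g : g \in Act -> g \in activity_part g.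
Proof. by case/ActP=> -[gS ->]; apply: part_start. Qed.

Lemma activity_part_inj g h e : g \in Act -> h \in Act ->
  e \in activity_part g -> e \in activity_part h -> g = h.
Proof.
have GD' g' h' : e \in part G g' -> e \in part D h' -> g = h.
  by move=> /partP[/GD nD _] /partP[eD _]; case/negP: (nD h').
case/ActP=> -[gS ->] /ActP[] [hS ->].
- exact: part_inj.
- exact: GD'.
- by move=> eD eG; apply: GD' eG eD.
- exact: part_inj.
Qed.

Lemma saturated0 : saturated set0.
Proof.
by apply/saturatedP; split=> [e|g e _ _]; rewrite !inE.
Qed.

Lemma saturated_symdiff A B :
  saturated A -> saturated B -> saturated (symdiff A B).
Proof.
move=> /saturatedP[covA satA] /saturatedP[covB satB]; apply/saturatedP; split.
  by move=> e; rewrite !inE => /orP[]/andP[_]; [apply: covA|apply: covB].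
by move=> g e gA eg; rewrite !inE (satA g) // (satB g).
Qed.

Lemma saturatedG t : saturated (G t).
Proof.
apply/saturatedP; split.
  move=> e /(family_part fG)[g gS eg]; exists g; first by rewrite inE gS.
  by rewrite /activity_part gS.
move=> g e /ActP[][gS ->] eg; first exact: part_in_family.
have nG h s : h \in D s -> h \in G t = false.
  by move=> hD; apply: contraTF hD => /GD.
move: eg gS => /partP[eg _]; rewrite inE => gg.
by rewrite (nG _ _ eg) (nG _ _ gg).
Qed.

Lemma saturatedD t : saturated (D t).
Proof.
apply/saturatedP; split.
  move=> e /(family_part fD)[g gS eg]; exists g; first by rewrite inE gS orbT.
  by rewrite /activity_part startsD_notG.
move=> g e /ActP[][gS ->] eg; last exact: part_in_family.
move: eg gS => /partP[eg _]; rewrite inE => gg.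
by rewrite (negPf (GD t eg)) (negPf (GD t gg)).
Qed.

Definition parts : {set {set E}} := [set activity_part g | g in Act].

Lemma saturated_cover B :
  saturated B = [exists P in powerset parts, B == cover P].
Proof.
apply/saturatedP/exists_inP=> [[covB satB]|[P]].
  exists [set activity_part g | g in Act :&: B].
    by rewrite powersetE imsetS // subsetIl.
  apply/eqP/setP=> e; apply/idP/bigcupP.
    move=> eB; have [g gA eg] := covB e eB; exists (activity_part g) => //.
    by apply: imset_f; rewrite in_setI gA -(satB g e).
  by case=> C /imsetP[g /setIP[gA gB] ->] eg; rewrite (satB g).
rewrite powersetE => /subsetP sP /eqP->; split.
  move=> e /bigcupP[C /sP/imsetP[g gA ->] eg]; by exists g.
move=> g e gA eg; apply/bigcupP/bigcupP=> -[C CP eC].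
  exists C => //; have /imsetP[h hA defC] := sP C CP.
  rewrite defC in eC *; rewrite (activity_part_inj gA hA eg eC).
  exact: activity_part_start.
exists C => //; have /imsetP[h hA defC] := sP C CP.
rewrite defC in eC *.
by rewrite -(activity_part_inj gA hA (activity_part_start gA) eC).
Qed.

Definition union_parts S : {set E} := \bigcup_(g in S) activity_part g.

Lemma saturated_union S : S \subset Act -> saturated (union_parts S).
Proof.
move/subsetP=> sS; rewrite saturated_cover; apply/exists_inP.
exists [set activity_part g | g in S].
  by rewrite powersetE imsetS //; apply/subsetP.
by rewrite /cover big_imset_idem //=; apply: setUid.
Qed.

Lemma union_parts_Act S : S \subset Act -> union_parts S :&: Act = S.
Proof.
move/subsetP=> sS; apply/setP=> g; rewrite in_setI; apply/andP/idP.
  case=> /bigcupP[h hS gh] gA.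
  by rewrite (activity_part_inj gA (sS h hS) (activity_part_start gA) gh).
move=> gS; split; last exact: sS.
by apply/bigcupP; exists g; rewrite // activity_part_start ?sS.
Qed.

End TwoFamilies.

(** The sets G_k or the complements of the sets H_k, depending on the family. *)
Definition flat Phi k : {set E} :=
  if onth (sorted_enum (starts Phi)) k is Some g then Phi g else set0.

Lemma flat_parts Phi : decreasing_family Phi ->
  [set flat Phi k :\: flat Phi k.+1 | k : 'I_#|starts Phi|] =
  [set part Phi g | g in starts Phi].
Proof.
move=> fPhi; pose sq := sorted_enum (starts Phi).
have size_sq : size sq = #|starts Phi| by rewrite size_sort -cardE.
have mem_sq g : (g \in sq) = (g \in starts Phi) by rewrite mem_sort mem_enum.
have uniq_sq : uniq sq by rewrite sort_uniq enum_uniq.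
have sorted_sq : sorted <=%O sq by apply: sort_le_sorted.
have lt_sq g0 i j : i < j -> j < size sq -> (nth g0 sq i < nth g0 sq j)%O.
  move=> ij jsz; apply: (sorted_ltn_nth lt_trans g0 _ i j) => //.
    by rewrite lt_sorted_uniq_le uniq_sq.
  exact: ltn_trans jsz.
have le_sq g0 i j : i <= j -> j < size sq -> (nth g0 sq i <= nth g0 sq j)%O.
  rewrite leq_eqVlt => /orP[/eqP->//|ij jsz]; exact/ltW/lt_sq.
have flatE g0 k : flat Phi k = if k < size sq then Phi (nth g0 sq k) else set0.
  rewrite /flat -/sq; case: ltnP => ksz.
    have := onthTE sq k; rewrite ksz; case onth_k: (onth sq k) => [g|] // _.
    by rewrite (onth_nth g0 g sq k onth_k).
  by rewrite onth_default.
have main g0 k : k < size sq ->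
    flat Phi k :\: flat Phi k.+1 = part Phi (nth g0 sq k).
  move=> ksz; apply/setP=> e; rewrite in_setD (flatE g0) (flatE g0 k) ksz.
  apply/andP/partP=> -[]; last first.
    move=> ek maxk; split=> //; case: ltnP => k1sz; last by rewrite inE.
    apply: maxk; last exact: lt_sq.
    by rewrite -mem_sq mem_nth.
  move=> nek ek; split=> // h; rewrite -mem_sq => hsq kh.
  rewrite -(nth_index g0 hsq) in kh *; set j := index h sq in kh *.
  have jsz : j < size sq by rewrite index_mem.
  have kj : k < j.
    by rewrite ltnNge; apply: contraTN kh => /le_sq le; rewrite -leNgt le.
  apply: contra nek; rewrite (leq_ltn_trans kj jsz).
  exact/subsetP/family_le/le_sq.
apply/setP=> C; apply/imsetP/imsetP=> [[k _ ->]|[g gS ->]].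
  have ksz : k < size sq by rewrite size_sq.
  have [g0 _] : exists g0 : E, true by case: (sq) ksz => // g0; exists g0.
  by exists (nth g0 sq k); [rewrite -mem_sq mem_nth | rewrite (main g0)].
have isz : index g sq < #|starts Phi| by rewrite -size_sq index_mem mem_sq.
exists (Ordinal isz) => //=; rewrite (main g) ?nth_index ?mem_sq //.
by rewrite size_sq.
Qed.

End Parts.

(** * Activity classes *)

Section Classes.
Variables (d : Order.disp_t) (E : finOrderType d).
Implicit Types (M N : oriented_matroid E) (A B S K : {set E}) (e g h t : E).

Definition cyclic_family M : {ffun E -> {set E}} :=
  [ffun t => above (poscircuits M) t].

Definition acyclic_family N : {ffun E -> {set E}} :=
  [ffun t => above (poscocircuits N) t].

Lemma above_decreasing F : decreasing_family [ffun t : E => above F t].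
Proof.
split=> [e t|s t st|e t]; rewrite ?ffunE.
- exact: above_ge.
- exact: le_above.
- by case/above_mins=> g []; rewrite mem_mins; exists g; rewrite !ffunE.
Qed.

Lemma starts_above F : starts [ffun t : E => above F t] = mins F.
Proof. by apply/setP=> g; rewrite [RHS]mem_mins inE ffunE. Qed.

Lemma starts_cyclic M : starts (cyclic_family M) = active M.
Proof. exact: starts_above. Qed.

Lemma starts_acyclic N : starts (acyclic_family N) = dual_active N.
Proof. exact: starts_above. Qed.

Lemma cyclic_partsE M : cyclic_parts M =
  [set part (cyclic_family M) g | g in starts (cyclic_family M)].
Proof.
rewrite -(flat_parts (above_decreasing _)) [in RHS]starts_cyclic.
have flatE k : cyclic_flat M k = flat (cyclic_family M) k.
  rewrite /flat starts_cyclic /cyclic_flat; case: onth => // g.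
  by rewrite ffunE.
by apply: eq_imset => k; rewrite !flatE.
Qed.

Lemma acyclic_partsE N : acyclic_parts N =
  [set part (acyclic_family N) h | h in starts (acyclic_family N)].
Proof.
rewrite -(flat_parts (above_decreasing _)) [in RHS]starts_acyclic.
have flatE k : acyclic_flat N k = ~: flat (acyclic_family N) k.
  rewrite /flat starts_acyclic /acyclic_flat; case: onth => [h|].
    by rewrite ffunE.
  by rewrite setC0.
by apply: eq_imset => k; rewrite !flatE !setDE setCK setIC.
Qed.

Section FixedPerspective.
Variables M N : oriented_matroid E.
Hypothesis MN : refines M N.

Let Gf A := cyclic_family (reorient A M).
Let Df A := acyclic_family (reorient A N).
Let sat A B := saturated (Gf A) (Df A) B.
Let actives A := Act (Gf A) (Df A).

Let fG A : decreasing_family (Gf A). Proof. exact: above_decreasing. Qed.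
Let fD A : decreasing_family (Df A). Proof. exact: above_decreasing. Qed.
Let GD A e s t : e \in Gf A s -> e \notin Df A t.
Proof. rewrite !ffunE; exact/disjoint_GD/refines_reorient. Qed.

Lemma symdiffA A B S : symdiff (symdiff A B) S = symdiff A (symdiff B S).
Proof.
apply/setP=> e; rewrite !inE.
by case: (e \in A); case: (e \in B); case: (e \in S).
Qed.

Lemma symdiff0 A : symdiff A set0 = A.
Proof. by apply/setP=> e; rewrite !inE; case: (e \in A). Qed.

Lemma symdiffv A : symdiff A A = set0.
Proof. by apply/setP=> e; rewrite !inE; case: (e \in A). Qed.

Lemma symdiffC A B : symdiff A B = symdiff B A.
Proof. exact: setUC. Qed.

Lemma reorient_symdiffG A B s :
  Gf (symdiff A B) s = above (poscircuits (reorient B (reorient A M))) s.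
Proof. by rewrite ffunE (eq_poscircuits (circuits_reorient2 A B M)). Qed.

Lemma reorient_symdiffD A B s :
  Df (symdiff A B) s = above (poscocircuits (reorient B (reorient A N))) s.
Proof. by rewrite ffunE (eq_poscocircuits (circuits_reorient2 A B N)). Qed.

Lemma families_flip A B t : B = Gf A t \/ B = Df A t ->
  Gf (symdiff A B) = Gf A /\ Df (symdiff A B) = Df A.
Proof.
have MNA := refines_reorient (A := A) MN.
case=> eB; split; apply/ffunP=> s.
- by rewrite reorient_symdiffG eB !ffunE G_flip.
- by rewrite reorient_symdiffD eB !ffunE (D_flip_G _ _ MNA).
- by rewrite reorient_symdiffG eB !ffunE (G_flip_D _ _ MNA).
- by rewrite reorient_symdiffD eB !ffunE D_flip.
Qed.

(** Induction on the least active element [g] in [B]: the symmetric difference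
    of [B] with the set of threshold [g] is still a union of parts, and all
    its active elements are greater than [g]. *)
Lemma families_saturated A B : sat A B ->
  Gf (symdiff A B) = Gf A /\ Df (symdiff A B) = Df A.
Proof.
have base A' B' : sat A' B' -> B' :&: actives A' = set0 ->
    Gf (symdiff A' B') = Gf A' /\ Df (symdiff A' B') = Df A'.
  move=> /saturatedP[covB satB] B0; suff -> : B' = set0 by rewrite symdiff0.
  apply/setP=> e; rewrite inE; apply/negbTE/negP=> eB.
  have [g gA eg] := covB e eB; move/setP/(_ g): B0.
  by rewrite in_setI in_set0 -(satB g e gA eg) eB gA.
suff IH n A' B' : sat A' B' ->
    (forall g, g \in B' :&: actives A' -> #|[set h | (g <= h)%O]| <= n) ->
    Gf (symdiff A' B') = Gf A' /\ Df (symdiff A' B') = Df A'.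
  by move=> sAB; apply: (IH #|E|) => // g _; apply: max_card.
elim: n A' B' => [|n IHn] A' B' sAB le_n.
  apply: base => //; apply/setP=> g; rewrite in_set0; apply/negP=> /le_n.
  by rewrite leqn0 cards_eq0 => /eqP/setP/(_ g); rewrite !inE lexx.
have [B0|[g0 g0B]] := set_0Vmem (B' :&: actives A'); first exact: base.
have [g gBA min_g] := set_min g0B; have /setIP[gB gA] := gBA.
have [F [F_flip F_sat F_g geF]] : exists F,
    [/\ F = Gf A' g \/ F = Df A' g, sat A' F, g \in F
      & forall h, h \in F -> (g <= h)%O].
  case/setUP: gA; rewrite inE => gS; [exists (Gf A' g)|exists (Df A' g)].
    split=> [|||h]; [by left | | by [] | exact: (family_ge (fG A'))].
    exact: saturatedG (fG A') (@GD A') g.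
  split=> [|||h]; [by right | | by [] | exact: (family_ge (fD A'))].
  exact: saturatedD (fD A') (@GD A') g.
have [eqG eqD] := families_flip F_flip.
have sat1 : sat (symdiff A' F) (symdiff B' F).
  by rewrite /sat eqG eqD; apply: saturated_symdiff.
have := IHn (symdiff A' F) (symdiff B' F) sat1.
rewrite symdiffA [symdiff F _]symdiffC symdiffA symdiffv symdiff0 eqG eqD.
apply.
move=> h; rewrite /actives eqG eqD in_setI => /andP[hBF hA].
have gh : (g < h)%O.
  rewrite lt_neqAle; apply/andP; split.
    by apply: contraTneq hBF => <-; rewrite !inE gB F_g.
  move: hBF; rewrite inE !in_setD => /orP[]/andP[_ hB]; last exact: geF.
  by apply: min_g; rewrite in_setI hB.
rewrite -ltnS; apply: leq_trans (le_n g gBA).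
apply/proper_card/properP; split.
  by apply/subsetP=> k; rewrite !inE; apply/le_trans/ltW.
by exists g; rewrite !inE ?lexx // -ltNge.
Qed.

Lemma classP A B : reflect (exists2 S, sat A S & B = symdiff A S)
  (B \in activity_class M N A).
Proof.
have partsE : cyclic_parts (reorient A M) :|: acyclic_parts (reorient A N) =
    parts (Gf A) (Df A).
  rewrite /parts /Act imsetU cyclic_partsE acyclic_partsE; congr (_ :|: _).
    by apply: eq_in_imset => g gS; rewrite /activity_part gS.
  apply: eq_in_imset => g gS; by rewrite /activity_part (startsD_notG (@GD A)).
rewrite /activity_class partsE.
apply: (iffP imsetP) => [[P sP ->]|[S satS ->]].
  exists (cover P) => //; rewrite /sat (saturated_cover (fG A) (fD A) (@GD A)).
  by apply/exists_inP; exists P.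
have := satS; rewrite /sat (saturated_cover (fG A) (fD A) (@GD A)).
by case/exists_inP=> P sP /eqP eS; exists P; rewrite // eS.
Qed.

Lemma class_families A B : B \in activity_class M N A ->
  Gf B = Gf A /\ Df B = Df A.
Proof. by case/classP=> S satS ->; apply: families_saturated. Qed.

Lemma class_refl A : A \in activity_class M N A.
Proof.
by apply/classP; exists set0; [exact: saturated0 | rewrite symdiff0].
Qed.

Lemma class_eq A B : B \in activity_class M N A ->
  activity_class M N B = activity_class M N A.
Proof.
move=> BA; have [eqG eqD] := class_families BA.
have /classP[S satS eB] := BA.
have satB K : sat B K = sat A K by rewrite /sat eqG eqD.
apply/setP=> K; apply/classP/classP=> -[T satT ->].
  exists (symdiff S T); last by rewrite eB symdiffA.
  have satAT : sat A T by rewrite -(satB T).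
  exact: saturated_symdiff satS satAT.
exists (symdiff S T); first by rewrite satB; exact: saturated_symdiff satS satT.
by rewrite eB -symdiffA [symdiff (symdiff A S) S]symdiffA symdiffv symdiff0.
Qed.

Lemma class_active A B : B \in activity_class M N A ->
  active (reorient B M) = active (reorient A M) /\
  dual_active (reorient B N) = dual_active (reorient A N).
Proof.
move=> /class_families[eqG eqD]; rewrite -!starts_cyclic -!starts_acyclic.
by rewrite -/(Gf B) -/(Df B) eqG eqD.
Qed.

Definition fixed A := active_fixed M A && dual_active_fixed N A.

Lemma fixedE A : fixed A = (actives A :&: A == set0).
Proof.
rewrite /fixed /active_fixed /dual_active_fixed /actives /Act setIUl setU_eq0.
by rewrite starts_cyclic starts_acyclic.
Qed.

(** A nonempty union of parts contains an active element; if [A] and [B] differ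
    by that union, one of them contains the element. *)
Lemma fixed_class_inj A B : fixed A -> fixed B ->
  B \in activity_class M N A -> B = A.
Proof.
rewrite !fixedE => /eqP fixA /eqP fixB BA; have [eqG eqD] := class_families BA.
have /classP[S /saturatedP[covS satS] eB] := BA.
suff S0 : S = set0 by rewrite eB S0 symdiff0.
apply/setP=> e; rewrite in_set0; apply/negbTE/negP=> eS.
have [g gA eg] := covS e eS; rewrite (satS g e gA eg) in eS.
have gnA : g \notin A.
  by apply/negP=> gA'; move/setP/(_ g): fixA; rewrite in_setI gA gA' inE.
move/setP/(_ g): fixB; rewrite /actives eqG eqD in_setI gA eB !inE.
by rewrite eS (negPf gnA).
Qed.

(** The parts whose active element lies in [A] are reoriented. *)
Lemma class_has_fixed A : exists2 B, fixed B & B \in activity_class M N A.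
Proof.
pose S := union_parts (Gf A) (Df A) (A :&: actives A).
have satS : sat A S.
  exact: saturated_union (fG A) (fD A) (@GD A) _ (subsetIr _ _).
have BA : symdiff A S \in activity_class M N A by apply/classP; exists S.
exists (symdiff A S) => //; rewrite fixedE.
have [eqG eqD] := class_families BA; rewrite /actives eqG eqD.
apply/eqP/setP=> g; rewrite in_setI in_set0; apply/negbTE/negP=> /andP[gA].
have := union_parts_Act (fG A) (fD A) (@GD A) (subsetIr A (actives A)).
move/setP/(_ g); rewrite -/S !in_setI gA !andbT => eSA.
by rewrite !inE eSA; case: (g \in A).
Qed.

(** The fixed reorientations form a system of representatives. *)
Lemma card_classes (P : pred {set E}) :
  (forall A B, B \in activity_class M N A -> P B = P A) ->
  #|[set K in activity_classes M N | [forall A in K, P A]]| =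
  #|[set A | P A && fixed A]|.
Proof.
move=> invP; rewrite -(card_in_imset (f := activity_class M N)); last first.
  move=> A B; rewrite !inE => /andP[_ fA] /andP[_ fB] eqAB.
  by apply/esym/fixed_class_inj; rewrite // eqAB class_refl.
apply: eq_card => K; rewrite inE; apply/andP/imsetP.
  case=> /imsetP[A _ ->] /forall_inP allP; have [B fB BA] := class_has_fixed A.
  exists B; last by rewrite (class_eq BA).
  by rewrite inE fB allP.
case=> A; rewrite inE => /andP[PA fA] ->; split; first exact: imset_f.
by apply/forall_inP=> B BA; rewrite (invP A).
Qed.

End FixedPerspective.
End Classes.

(** * Counting reorientations *)

Section Counting.
Variables (d : Order.disp_t) (E : finOrderType d).
Implicit Types (M N : oriented_matroid E) (A S : {set E}).
Local Open Scope ring_scope.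

(** The meaning of a product of weights in {0, 1}: [c] and [d0] say whether
    elements of [S] may lie outside and inside [A]. *)
Definition allowed (c d0 : bool) S A :=
  [forall e, (e \in S) ==> (if e \in A then d0 else c)].

Lemma allowedTT S A : allowed true true S A = true.
Proof. by apply/forallP=> e; case: ifP; rewrite implybT. Qed.

Lemma allowedTF S A : allowed true false S A = (S :&: A == set0).
Proof.
apply/forallP/eqP => [SA|/setP SA e].
  apply/setP=> e; rewrite in_setI in_set0; have := SA e.
  by case: (e \in S); case: (e \in A).
by have := SA e; rewrite in_setI in_set0; case: (e \in S); case: (e \in A).
Qed.

Lemma allowedFF S A : allowed false false S A = (S == set0).
Proof.
apply/forallP/eqP => [SA|-> e]; last by rewrite inE.
by apply/setP=> e; have := SA e; rewrite in_set0 if_same implybF => /negbTE.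
Qed.

Lemma prod_bool (R : comNzRingType) (p : pred E) :
  \prod_e (p e)%:R = ([forall e, p e])%:R :> R.
Proof.
have [/forallP pe|] := boolP [forall e, p e].
  by apply: big1 => e _; rewrite pe.
by case/forallPn=> e npe; rewrite (bigD1 e) //= (negPf npe) mul0r.
Qed.

Lemma tutte_eval_card M N (a b c d0 : bool) : refines M N ->
  tutte_eval M N (a%:R + b%:R) (c%:R + d0%:R) 1 =
  Posz #|[set A | allowed c d0 (active (reorient A M)) A &&
                  allowed a b (dual_active (reorient A N)) A]|.
Proof.
move=> MN; rewrite /tutte_eval; set v := tnth _.
have vE k : ('X_k).@[v] = v k := mevalXU v k.
rewrite (@tutte_expansion _ E int M N a%:R b%:R c%:R d0%:R (meval v) MN
  (vE 0) (vE 1) (vE 2)).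
rewrite -sum1_card [in RHS]big_mkcond /= -natz natr_sum; apply: eq_bigr => A _.
have -> : (if A \in [set A | allowed c d0 (active (reorient A M)) A &&
    allowed a b (dual_active (reorient A N)) A] then 1%N else 0%N)%:R =
  (allowed c d0 (active (reorient A M)) A &&
   allowed a b (dual_active (reorient A N)) A)%:R :> int.
  by rewrite inE; case: (_ && _).
rewrite -mulnb natrM /allowed -!prod_bool -big_split /=.
apply: eq_bigr => e _; case: (e \in A).
  by case: (e \in active _); case: (e \in dual_active _).
by case: (e \in active _); case: (e \in dual_active _).
Qed.

Lemma prod_fixed (R : comNzRingType) S A (x : R) :
  \prod_e (if e \in S then if e \in A then 0 else x else 1) =
  if S :&: A == set0 then x ^+ #|S| else 0.
Proof.
have [SA0|[e /setIP[eS eA]]] := set_0Vmem (S :&: A); last first.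
  rewrite (bigD1 e) //= eS eA mul0r ifN //.
  by apply/set0Pn; exists e; rewrite in_setI eS.
rewrite SA0 eqxx -prodr_const [RHS]big_mkcond; apply: eq_bigr => e _.
move/setP/(_ e): SA0; rewrite in_setI in_set0.
by case: (e \in S) => //= ->.
Qed.

Lemma coef_monomial (p q i j : nat) :
  ('X_(0 : 'I_2) ^+ p * 'X_(1 : 'I_2) ^+ q : {mpoly int[2]})
    @_[multinom [tuple i; j]] = ((p == i) && (q == j))%:R.
Proof.
rewrite !mpolyXn -mpolyXD mcoeffX; congr (nat_of_bool _)%:R.
apply/eqP/andP => [/mnmP eqm|[/eqP-> /eqP->]].
  have := eqm 0; have := eqm 1; rewrite !mnmDE !mulmnE !mnm1E.
  rewrite !multinomE /= !(tnth_nth 0%N) /= !mul0n !mul1n add0n addn0.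
  by move=> -> ->.
apply/mnmP=> k; rewrite mnmDE !mulmnE !mnm1E multinomE (tnth_nth 0%N).
by case: k => [[|[|k]] //= ltk]; rewrite ?mul0n ?mul1n ?addn0 ?add0n.
Qed.

Lemma tutte_coef_card M N i j : refines M N ->
  tutte_coef M N i j =
  Posz #|[set A : {set E} | [&& #|dual_active (reorient A N)| == i,
            #|active (reorient A M)| == j,
            active_fixed M A & dual_active_fixed N A]]|.
Proof.
move=> MN; rewrite /tutte_coef; set lq := [tuple 'X_0; 'X_1; 1].
have lqE (k : 'I_3) y : lq`_k = y -> 'X_k \mPo lq = y.
  by move=> <-; apply: comp_mpolyXU.
rewrite (@tutte_expansion _ E {mpoly int[2]} M N 'X_(0 : 'I_2) 0
  'X_(1 : 'I_2) 0 (comp_mpoly lq) MN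
  (lqE 0 _ _) (lqE 1 _ _) (lqE 2 _ _)) ?addr0 //.
rewrite raddf_sum -sum1_card [in RHS]big_mkcond /= -natz natr_sum.
apply: eq_bigr => A _; rewrite big_split /= !prod_fixed !inE.
rewrite /active_fixed /dual_active_fixed.
case: (_ == set0); last by rewrite mul0r mcoeff0 !andbF.
case: (_ == set0); last by rewrite mulr0 mcoeff0 !andbF.
by rewrite mulrC coef_monomial !andbT; case: (_ && _).
Qed.

End Counting.

Theorem proposition10 (d : Order.disp_t) (E : finOrderType d)
    (M N : oriented_matroid E) (HMN : perspective M N) :
  (forall i j : nat,
      tutte_coef M N i j =
        Posz #|[set K in activity_classes M N |
                [forall A in K, (#|dual_active (reorient A N)| == i)
                                && (#|active (reorient A M)| == j)]]|
   /\ tutte_coef M N i j =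
        Posz #|[set A : {set E} |
                [&& #|dual_active (reorient A N)| == i,
                    #|active (reorient A M)| == j,
                    active_fixed M A & dual_active_fixed N A]]|)
  /\
  [/\ Posz #|[set: {set E}]| = tutte_eval M N 2 2 1,
      Posz #|[set A : {set E} | acyclic (reorient A M)]|
        = tutte_eval M N 2 0 1,
      Posz #|[set A : {set E} | totally_cyclic (reorient A N)]|
        = tutte_eval M N 0 2 1,
      Posz #|[set A : {set E} | acyclic (reorient A M)
                                & dual_active_fixed N A]|
        = tutte_eval M N 1 0 1
      /\ Posz #|[set K in activity_classes M N |
                 [forall A in K, acyclic (reorient A M)]]|
        = tutte_eval M N 1 0 1
    & [/\ Posz #|[set A : {set E} | active_fixed M A
                                    & totally_cyclic (reorient A N)]|
            = tutte_eval M N 0 1 1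
          /\ Posz #|[set K in activity_classes M N |
                     [forall A in K, totally_cyclic (reorient A N)]]|
            = tutte_eval M N 0 1 1,
          Posz #|[set A : {set E} | active_fixed M A]|
            = tutte_eval M N 2 1 1,
          Posz #|[set A : {set E} | dual_active_fixed N A]|
            = tutte_eval M N 1 2 1,
          Posz #|[set A : {set E} | active_fixed M A & dual_active_fixed N A]|
            = tutte_eval M N 1 1 1
          /\ Posz #|activity_classes M N| = tutte_eval M N 1 1 1
        & Posz #|[set A : {set E} | acyclic (reorient A M)
                                    & totally_cyclic (reorient A N)]|
            = tutte_eval M N 0 0 1
          /\ Posz #|[set K in activity_classes M N |
                     [forall A in K, acyclic (reorient A M)
                                     && totally_cyclic (reorient A N)]]|
            = tutte_eval M N 0 0 1]].
Proof.
have MN := perspective_refines HMN.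
have card_ev (a b c d0 : bool) (P : pred {set E}) :
    (forall A, P A = allowed c d0 (active (reorient A M)) A &&
                     allowed a b (dual_active (reorient A N)) A) ->
    Posz #|[set A | P A]| =
    tutte_eval M N (a%:R + b%:R)%R (c%:R + d0%:R)%R 1%R.
  move=> eP; rewrite tutte_eval_card //; congr (Posz _); apply: eq_card => A.
  by rewrite !inE eP.
have card_cls (P : pred {set E}) :
    (forall A B, B \in activity_class M N A -> P B = P A) ->
    #|[set K in activity_classes M N | [forall A in K, P A]]| =
    #|[set A | P A && fixed M N A]| := card_classes MN (P := P).
have clsM A B : B \in activity_class M N A ->
    active (reorient B M) = active (reorient A M).
  by case/(class_active MN).
have clsN A B : B \in activity_class M N A ->
    dual_active (reorient B N) = dual_active (reorient A N).
  by case/(class_active MN).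
have acyclic_fixed A : acyclic (reorient A M) -> active_fixed M A.
  by rewrite acyclicE /active_fixed => /eqP->; rewrite set0I.
have cyclic_fixed A : totally_cyclic (reorient A N) -> dual_active_fixed N A.
  by rewrite totally_cyclicE /dual_active_fixed => /eqP->; rewrite set0I.
have acyclic_ev : Posz #|[set A : {set E} | acyclic (reorient A M)
    & dual_active_fixed N A]| = tutte_eval M N 1 0 1.
  apply: (card_ev true false false false) => A.
  by rewrite allowedFF allowedTF acyclicE.
have cyclic_ev : Posz #|[set A : {set E} | active_fixed M A
    & totally_cyclic (reorient A N)]| = tutte_eval M N 0 1 1.
  apply: (card_ev false false true false) => A.
  by rewrite allowedFF allowedTF totally_cyclicE.
have fixed_ev : Posz #|[set A : {set E} | active_fixed M A
    & dual_active_fixed N A]| = tutte_eval M N 1 1 1.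
  apply: (card_ev true false true false) => A.
  by rewrite !allowedTF.
have both_ev : Posz #|[set A : {set E} | acyclic (reorient A M)
    & totally_cyclic (reorient A N)]| = tutte_eval M N 0 0 1.
  apply: (card_ev false false false false) => A.
  by rewrite !allowedFF acyclicE totally_cyclicE.
split=> [i j|]; first split.
- rewrite tutte_coef_card // card_cls.
    by congr (Posz _); apply: eq_card => A; rewrite !inE andbA.
  by move=> A B BA; rewrite (clsM A B BA) (clsN A B BA).
- exact: tutte_coef_card.
split.
- apply: (card_ev true true true true (fun=> true)) => A.
  by rewrite !allowedTT.
- apply: (card_ev true true false false) => A.
  by rewrite allowedFF allowedTT andbT acyclicE.
- apply: (card_ev false false true true) => A.
  by rewrite allowedFF allowedTT totally_cyclicE.
- split=> //; rewrite -acyclic_ev card_cls.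
    congr (Posz _); apply: eq_card => A; rewrite !inE /fixed.
    by case: (boolP (acyclic _)) => // /acyclic_fixed->.
  by move=> A B BA; rewrite !acyclicE (clsM A B BA).
split.
- split=> //; rewrite -cyclic_ev card_cls.
    congr (Posz _); apply: eq_card => A; rewrite !inE /fixed.
    by case: (boolP (totally_cyclic _)) => [/cyclic_fixed->|_]; rewrite ?andbF.
  by move=> A B BA; rewrite !totally_cyclicE (clsN A B BA).
- apply: (card_ev true true true false) => A.
  by rewrite allowedTF allowedTT andbT.
- apply: (card_ev true false true true) => A.
  by rewrite allowedTF allowedTT.
- split=> //; rewrite -fixed_ev; congr (Posz _).
  have := card_cls (fun=> true) (fun _ _ _ => erefl).
  set C := #|_| => eC; rewrite -[RHS]/(#|[set A | true && fixed M N A]|) -eC.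
  rewrite /C; apply: eq_card => K; rewrite inE; apply/esym/andb_idr => _.
  exact/forall_inP.
split=> //; rewrite -both_ev card_cls.
  congr (Posz _); apply: eq_card => A; rewrite !inE /fixed.
  by case: (boolP (acyclic _)) => [/acyclic_fixed->|//];
     case: (boolP (totally_cyclic _)) => [/cyclic_fixed->|//].
move=> A B BA.
by rewrite !acyclicE !totally_cyclicE (clsM A B BA) (clsN A B BA).
Qed.
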